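(* Let $X$ be an $n$-dimensional Fano manifold, let $k$ be a (large) positive integer such that $-kK_X$ is very ample, and let $N_k=\dim H^0(X,-kK_X)$. Let $H_0\in\mathcal{B}_k$ be a positive definite hermitian form on $H^0(X,-kK_X)$ and let $\underline{s}_0=(s_1,\dots,s_{N_k})$ be an $H_0$-orthonormal basis, used to embed $X$ in $\mathbb{CP}^{N_k-1}$. Then for all hermitian matrices $A,B\in\sqrt{-1}\mathfrak{u}(N_k)$ the Hessian at $H_0$ of the quantized Ding functional $\mathcal{D}^{(k)}$ is given by $$\nabla^2\mathcal{D}^{(k)}{}_{|H_0}(A,B)=k^{-1}\int_X \mathrm{Re}(\xi_A,\xi_B)_{FS}\,\mu_{FS_k(H_0)}-k^{-2}\int_X H(A)H(B)\,\mu_{FS_k(H_0)}+k^{-2}\int_X H(A)\,\mu_{FS_k(H_0)}\cdot\int_X H(B)\,\mu_{FS_k(H_0)},$$ where $\xi_A$ is the holomorphic vector field on $\mathbb{CP}^{N_k-1}$ corresponding to $A$, $H(A)$ is the Hamiltonian for the Killing vector field $J\xi_A^{\mathbb{R}}$, and $(\cdot,\cdot)_{FS}$ is the Fubini-Study inner product on tangent vectors (all restricted to $X\subset\mathbb{CP}^{N_k-1}$).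
   Context: Metrics. $\mathcal{H}(-K_X)$ is the space of smooth fiber metrics $\phi$ on $-K_X$ (additive notation: the squared norm is $|\cdot|^2_\phi=|\cdot|^2e^{-\phi}$, and $k\phi$ is the induced metric on $-kK_X$) with positive curvature $\omega_\phi=\frac{\sqrt{-1}}{2\pi}\partial\bar\partial\phi$. For $\phi\in\mathcal{H}(-K_X)$ the canonical volume form is $e^{-\phi}:=(\sqrt{-1})^{n^2}\left|\frac{\partial}{\partial z_1}\wedge\cdots\wedge\frac{\partial}{\partial z_n}\right|^2_\phi dz_1\wedge\cdots\wedge dz_n\wedge d\bar z_1\wedge\cdots\wedge d\bar z_n$ (independent of local holomorphic coordinates), and $\mu_\phi:=e^{-\phi}/\int_X e^{-\phi}$ is the associated probability measure. Hermitian forms. $\mathcal{B}_k$ is the space of (positive definite) hermitian forms on $H^0(X,-kK_X)$. For $H\in\mathcal{B}_k$, $FS_k(H):=\frac1k\log\left(k^{-n}\sup_{s\ne0}\frac{|s|^2}{H(s,s)}\right)\in\mathcal{H}(-K_X)$; equivalently $FS_k(H)=\frac1k\log(k^{-n}\sum_i|s_i|^2)$ for any $H$-orthonormal basis $(s_i)$. Given $H_0$ and an $H_0$-orthonormal basis $\underline{s}_0$, $X$ is identified with its image under $\iota_{\underline{s}_0}=[s_1:\cdots:s_{N_k}]:X\hookrightarrow\mathbb{CP}^{N_k-1}$. For $g\in GL(N_k,\mathbb{C})$, $H_g\in\mathcal{B}_k$ is the form for which $\underline{s}_0\cdot g$ is orthonormal (row vector times matrix); this gives $\mathcal{B}_k\simeq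 GL(N_k,\mathbb{C})/U(N_k)$. The tangent space of $\mathcal{B}_k$ is identified with the space $\sqrt{-1}\mathfrak{u}(N_k)$ of hermitian matrices, $A$ corresponding to the velocity at $t=0$ of the Bergman geodesic $t\mapsto H_{g(t)}$, $g(t)=e^{\frac12tA}$, and $\mathcal{B}_k$ carries the Riemannian structure given by $\mathrm{tr}(AB)$. Functional. The quantized Ding functional is, up to an additive constant, $\mathcal{D}^{(k)}(H)=\frac{1}{kN_k}\log\det(H\cdot H_0^{-1})-\log\int_Xe^{-FS_k(H)}$. Equivalently, its gradient is $\nabla\mathcal{D}^{(k)}{}_{|H_g}=k^{-1}\left(\int_X(M\circ g)\,\mu_{FS_k(H_g)}-\frac{\mathrm{Id}}{N_k}\right)$, where $M([Z_1:\cdots:Z_{N_k}])=\left(\frac{\overline{Z}_\alpha Z_\beta}{\sum_i|Z_i|^2}\right)_{\alpha\beta}$ and $g$ acts on $\mathbb{CP}^{N_k-1}$ by $Z\mapsto Zg$. Its Hessian $\nabla^2\mathcal{D}^{(k)}{}_{|H_0}$ is the symmetric bilinear form (Riemannian Hessian) on $\sqrt{-1}\mathfrak{u}(N_k)$ with $\nabla^2\mathcal{D}^{(k)}{}_{|H_0}(A,A)=\frac{d^2}{dt^2}\mathcal{D}^{(k)}(H_{e^{tA/2}})|_{t=0}$. Projective geometry. For hermitian $A=(A_{ij})$, $\xi_A$ is the push-forward to $\mathbb{CP}^{N_k-1}$ of $\sum_{i,j}A_{ij}Z_i\frac{\partial}{\partial Z_j}$, written $\xi_A=\xi_A^{\mathbb{R}}-\sqrt{-1}J\xi_A^{\mathbb{R}}$,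 and $H(A):=\mathrm{tr}(AM)$. It satisfies $i_{\xi_A}\omega_{FS}=\frac{\sqrt{-1}}{2\pi}\bar\partial H(A)$ and $i_{J\xi_A^{\mathbb{R}}}\omega_{FS}=-\frac1{4\pi}dH(A)$, where $\omega_{FS}=\frac{\sqrt{-1}}{2\pi}\partial\bar\partial\log\sum_i|Z_i|^2\in c_1(\mathcal{O}(1))$. $(\cdot,\cdot)_{FS}$ is the hermitian inner product on $(1,0)$-vectors with coefficients $g_{i\bar j}$ defined by $\omega_{FS}=\frac{\sqrt{-1}}{2\pi}\sum g_{i\bar j}dz_i\wedge d\bar z_j$. *)

(* Defs.v *)
From HB Require Import structures.
From mathcomp Require Import all_boot all_order all_algebra.
From mathcomp Require Import all_classical all_reals all_analysis.
From mathcomp Require Import complex.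

Set Implicit Arguments.
Unset Strict Implicit.
Unset Printing Implicit Defensive.

Import Order.TTheory GRing.Theory Num.Theory.
Import numFieldNormedType.Exports.

Local Open Scope classical_set_scope.
Local Open Scope ring_scope.
Local Open Scope complex_scope.

(* R[i] as a normed space over itself, so that 'rV[R[i]]_n is a complex normed
   space and [differentiable] means complex differentiable. *)
HB.instance Definition _ (R : realType) := GRing.ComAlgebra.copy R[i] R[i]^o.
HB.instance Definition _ (R : realType) := Vector.copy R[i] R[i]^o.
HB.instance Definition _ (R : realType) :=
  PseudoPointedMetric.copy R[i] R[i]^o.
HB.instance Definition _ (R : realType) := NormedModule.copy R[i] R[i]^o.

Definition sqnorm (R : realType) (z : R[i]) : R :=
  complex.Re z ^+ 2 + complex.Im z ^+ 2.

Definition expmx (R : realType) (N : nat) (A : 'M[R[i]]_N) : 'M[R[i]]_N :=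
  limn (series (fun j => j`!%:R^-1 *: A ^+ j)).

Record measure_space (R : realType) := MeasureSpace {
  msp_disp : measure_display ;
  msp_type : measurableType msp_disp ;
  msp_measure : {measure set msp_type -> \bar R} }.

Definition msp_prodR (R : realType) (S : measure_space R) : measure_space R :=
  @MeasureSpace R _ (msp_type S * measurableTypeR R)%type
    [the {measure set _ -> \bar R} of
     (msp_measure S \x @lebesgue_measure R)%E].

(* C^n.+1 is seen as (C^n * R) * R, the last two factors being the real and the
   imaginary part of the last coordinate. *)
Fixpoint lebC (R : realType) (n : nat) : measure_space R :=
  match n with
  | 0 => @MeasureSpace R _ unit [the {measure set unit -> \bar R} of dirac tt]
  | m.+1 => msp_prodR (msp_prodR (lebC R m))
  end.

Fixpoint lebC_coord (R : realType) (n : nat) :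
    msp_type (lebC R n) -> nat -> R[i] :=
  match n with
  | 0 => fun=> fun=> 0
  | m.+1 => fun p j =>
      if j == m then p.1.2 +i* p.2 else lebC_coord p.1.1 j
  end.

Definition lebC_point (R : realType) (n : nat) (p : msp_type (lebC R n)) :
    'rV[R[i]]_n := \row_j lebC_coord p j.

Definition integralC (R : realType) (n : nat) (D : set 'rV[R[i]]_n)
    (f : 'rV[R[i]]_n -> R) : R :=
  \int[msp_measure (lebC R n)]_(p in @lebC_point R n @^-1` D)
    f (lebC_point p).

(* [mparam i] is the inverse of the chart [mchart i : mdom i -> C^n]; both are
   total functions whose values off [mdom i], resp. off its image, are junk. *)
Record complex_manifold (R : realType) (n : nat) := ComplexManifold {
  mpoint :> topologicalType ;
  mindex : Type ;
  mdom : mindex -> set mpoint ;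
  mchart : mindex -> mpoint -> 'rV[R[i]]_n ;
  mparam : mindex -> 'rV[R[i]]_n -> mpoint ;
  chart_at : mpoint -> mindex ;
  mdom_chart_at : forall x, mdom (chart_at x) x ;
  open_mdom : forall i, open (mdom i) ;
  open_mchart : forall i, open (mchart i @` mdom i) ;
  mchartK : forall i x, mdom i x -> mparam i (mchart i x) = x ;
  continuous_mchart :
    forall i x, mdom i x -> {for x, continuous (mchart i)} ;
  continuous_mparam :
    forall i w, (mchart i @` mdom i) w -> {for w, continuous (mparam i)} ;
  holomorphic_transition : forall i j w,
    (mchart i @` (mdom i `&` mdom j)) w ->
    differentiable (mchart j \o mparam i) w }.

Definition jac (R : realType) (n : nat) (X : complex_manifold R n)
    (i j : mindex X) (x : X) : R[i] :=
  \det ('J (mchart j \o mparam i) (mchart i x)).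

(* The section is f_i * (d/dz_1 /\ ... /\ d/dz_n)^k over the chart z = mchart i.
   Since d/dz_1 /\ ... /\ d/dz_n = det(dw/dz) * d/dw_1 /\ ... /\ d/dw_n, the
   local functions satisfy f_j = det(dw/dz)^k * f_i, where w = mchart j.  They
   are extended by 0 so that equality of sections is equality of functions. *)
Definition is_section (R : realType) (n : nat) (X : complex_manifold R n)
    (k : nat) (f : mindex X -> X -> R[i]) : Prop :=
  [/\ forall i w, (mchart i @` mdom i) w -> differentiable (f i \o mparam i) w,
      forall i j x, mdom i x -> mdom j x -> f j x = jac i j x ^+ k * f i x &
      forall i x, ~ mdom i x -> f i x = 0].

Definition section_pred (R : realType) (n : nat) (X : complex_manifold R n)
    (k : nat) : {pred mindex X -> X -> R[i]} := fun f => `[< is_section k f >].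

Lemma section_predP (R : realType) (n : nat) (X : complex_manifold R n)
    (k : nat) (f : mindex X -> X -> R[i]) :
  reflect (is_section k f) (f \in @section_pred R n X k).
Proof. exact: asboolP. Qed.

Lemma section_submod (R : realType) (n : nat) (X : complex_manifold R n)
    (k : nat) : submod_closed (@section_pred R n X k).
Proof.
split.
  apply/section_predP; split.
  - by move=> i w _; rewrite (_ : _ \o _ = cst 0).
  - move=> i j x _ _; rewrite -[LHS]/(0 : R[i]) -[X in _ * X]/(0 : R[i]).
    by rewrite mulr0.
  - by [].
move=> a f g /section_predP[df tf zf] /section_predP[dg tg zg].
have E i x : (a *: f + g) i x = a * f i x + g i x by [].
apply/section_predP; split.
- move=> i w iw.
  have -> : (a *: f + g) i \o mparam i =
      a *: (f i \o mparam i) + (g i \o mparam i) by [].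
  apply: differentiableD; last exact: dg.
  by apply: differentiableZ; exact: df.
- by move=> i j x ix jx; rewrite !E (tf i j)// (tg i j)// mulrDr mulrCA.
- by move=> i x ix; rewrite E zf// zg// mulr0 addr0.
Qed.

HB.instance Definition _ (R : realType) (n : nat) (X : complex_manifold R n)
    (k : nat) := GRing.isSubmodClosed.Build R[i] (mindex X -> X -> R[i])
  (@section_pred R n X k) (@section_submod R n X k).

Record antican_section (R : realType) (n : nat) (X : complex_manifold R n)
    (k : nat) := AnticanSection {
  sec_fun :> mindex X -> X -> R[i] ;
  sec_funP : sec_fun \in @section_pred R n X k }.

HB.instance Definition _ (R : realType) (n : nat) (X : complex_manifold R n)
    (k : nat) := [isSub for @sec_fun R n X k].
HB.instance Definition _ (R : realType) (n : nat) (X : complex_manifold R n)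
    (k : nat) := [Choice of antican_section X k by <:].
HB.instance Definition _ (R : realType) (n : nat) (X : complex_manifold R n)
    (k : nat) := [SubChoice_isSubLmodule of antican_section X k by <:].

Definition is_basis (R : realType) (V : lmodType R[i]) (N : nat)
    (s : 'I_N -> V) : Prop :=
  forall v, exists! c : 'rV[R[i]]_N, v = \sum_j c 0 j *: s j.

(* The coordinates w_j = Z_j / Z_a (j != a) on the affine chart {Z_a != 0};
   the a-th one is the constant 1. *)
Definition affine (R : realType) (N : nat) (a : 'I_N) (Z : 'rV[R[i]]_N) :
    'rV[R[i]]_N :=
  (Z 0 a)^-1 *: Z.

(* Homogeneous coordinates [s_1 : ... : s_N] in the frame of chart i. *)
Definition hcoord (R : realType) (n : nat) (X : complex_manifold R n)
    (k N : nat) (s : 'I_N -> antican_section X k) (i : mindex X) (x : X) :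
    'rV[R[i]]_N :=
  \row_j s j i x.

Definition proj_coord (R : realType) (n : nat) (X : complex_manifold R n)
    (k N : nat) (s : 'I_N -> antican_section X k) (x : X) : 'rV[R[i]]_N :=
  hcoord s (chart_at x) x.

(* That is, the map [s_1 : ... : s_N] is defined everywhere, injective and an immersion;
   for compact X this is an embedding into CP^(N-1). *)
Definition is_embedding (R : realType) (n : nat) (X : complex_manifold R n)
    (k N : nat) (s : 'I_N -> antican_section X k) : Prop :=
  [/\ forall x, proj_coord s x != 0,
      forall x y c, proj_coord s x = c *: proj_coord s y -> x = y &
      forall i x a, mdom i x -> hcoord s i x 0 a != 0 ->
        forall v : 'rV[R[i]]_n,
        'D_v (affine a \o hcoord s i \o mparam i) (mchart i x) = 0 -> v = 0].

Definition very_ample (R : realType) (n : nat) (X : complex_manifold R n)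
    (k : nat) : Prop :=
  exists N (s : 'I_N -> antican_section X k), is_basis s /\ is_embedding s.

Definition fano (R : realType) (n : nat) (X : complex_manifold R n) : Prop :=
  [/\ hausdorff_space X, compact [set: X], connected [set: X],
      [set: X] !=set0 & exists2 k, (0 < k)%N & very_ample X k].

(* Auxiliary data used to integrate over X: a finite Borel partition, each
   piece of which has its closure in the domain of a given chart. *)
Record subordinate_partition (R : realType) (n : nat)
    (X : complex_manifold R n) := SubordinatePartition {
  psize : nat ;
  pchart : 'I_psize -> mindex X ;
  piece : 'I_psize -> set X ;
  borel_piece : forall p, <<s [set U : set X | open U] >> (piece p) ;
  closure_piece : forall p, closure (piece p) `<=` mdom (pchart p) ;
  trivIset_piece : trivIset setT piece ;
  cover_piece : \bigcup_p piece p = [set: X] }.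

Lemma subordinate_partition_exists (R : realType) (n : nat)
    (X : complex_manifold R n) :
  fano X -> inhabited (subordinate_partition X).
Proof.
move=> [hX cX _ [x0 _] _].
have /choice[U HU] : forall x : X, exists V : set X,
    [/\ open V, V x & closure V `<=` mdom (chart_at x)].
  move=> x; have nx : nbhs x (mdom (chart_at x)).
    by apply: open_nbhs_nbhs; split; [exact: open_mdom|exact: mdom_chart_at].
  have [B xB Bd] := compact_regular hX cX filterT nx.
  exists (interior B); split; first exact: open_interior.
    by [].
  by apply: subset_trans Bd; apply: closureS; exact: interior_subset.
have : finite_subset_cover [set: X] U [set: X].
  pose pX : ptopologicalType :=
    HB.pack (mpoint X : Type) (isPointed.Build X x0) (Topological.on X).
  have cX' : @cover_compact pX [set: X].
    by rewrite -(@compact_cover pX); exact: cX.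
  apply: cX'; first by move=> x _; case: (HU x).
  by move=> x _; exists x => //; case: (HU x).
move=> [D _ DX].
pose l : seq X := finmap.enum_fset D.
pose F (q : nat) : set X := nth set0 [seq U x | x <- l] q.
have Fo q : open (F q).
  rewrite /F; have [ql|ql] := ltnP q (size [seq U x | x <- l]).
    by have /mapP[x _ ->] := mem_nth set0 ql; case: (HU x).
  by rewrite nth_default //; exact: open0.
have Fc (q : nat) : (q < size l)%N -> exists i, closure (F q) `<=` @mdom _ _ X i.
  move=> ql; have : F q \in [seq U x | x <- l] by rewrite mem_nth ?size_map.
  by move=> /mapP[x _ ->]; exists (chart_at x); case: (HU x).
have /choice[c Hc] : forall p : 'I_(size l),
  exists i, closure (F p) `<=` @mdom _ _ X i by move=> p; exact: Fc.
constructor; apply: (@SubordinatePartition _ _ X (size l) c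
  (fun p => seqDU F p)).
- move=> p /=; have -> : seqDU F p = ~` (\bigcup_q
      (if q is 0 then ~` F p else \big[setU/set0]_(j < p) F j)).
    apply/seteqP; split => x /=.
      by move=> [Fx nx] [[|q] _ /=].
    move=> nx; split; last by move=> ?; apply: nx; exists 1.
    by apply: contrapT => ?; apply: nx; exists 0.
  rewrite -setTD; apply: sigma_algebraCD.
  apply: sigma_algebra_bigcup => -[|q].
    rewrite -setTD; apply: sigma_algebraCD.
    by apply: sub_sigma_algebra; exact: Fo.
  apply: sub_sigma_algebra => /=; rewrite -bigcup_mkord.
  by apply: bigcup_open => q0 _; exact: Fo.
- by move=> p; apply: subset_trans (Hc p); apply: closureS; exact: subset_seqDU.
- move=> p q _ _ pq; apply: val_inj.
  exact: (@trivIset_seqDU _ F p q).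
- rewrite -subTset => x _.
  have [y yD Uy] := DX x I.
  have : (\bigcup_q F q) x.
    exists (index y l) => //; rewrite /F (nth_map y) ?index_mem //.
    by rewrite nth_index.
  rewrite seqDU_bigcup_eq => -[q _ Fq].
  have ql : (q < size l)%N.
    rewrite ltnNge; apply/negP => lq; have {Fq} := subset_seqDU Fq.
    by rewrite /F nth_default // size_map.
  by exists (Ordinal ql).
Qed.

(* A fiber metric phi on -K_X is given by its local weights phi_i, with
   |d/dz_1 /\ ... /\ d/dz_n|^2_phi = e^(- phi_i) for z = mchart i.  As
   i^(n^2) dz_1...dz_n dzbar_1...dzbar_n = 2^n dx_1 dy_1 ... dx_n dy_n, the
   volume form e^(- phi) has density 2^n e^(- phi_i) in the chart z. *)
Definition vol_integral (R : realType) (n : nat) (X : complex_manifold R n)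
    (P : subordinate_partition X) (phi : mindex X -> X -> R) (F : X -> R) : R :=
  \sum_(p < psize P) let i := pchart p in
    integralC (mchart i @` piece p)
      (fun w => 2 ^+ n * expR (- phi i (mparam i w)) * F (mparam i w)).

Definition mu_integral (R : realType) (n : nat) (X : complex_manifold R n)
    (P : subordinate_partition X) (phi : mindex X -> X -> R) (F : X -> R) : R :=
  vol_integral P phi F / vol_integral P phi (fun=> 1).

Notation "''B(' X , k )" := {dot antican_section X k for Num.conj}
  (at level 8, format "''B(' X ,  k )").

Definition FS (R : realType) (n : nat) (X : complex_manifold R n) (k : nat)
    (H : 'B(X, k)) (i : mindex X) (x : X) : R :=
  k%:R^-1 * ln (k%:R ^- n *
    sup [set sqnorm (s i x) / complex.Re (H s s) |
          s in [set s : antican_section X k | s != 0]]).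

Definition is_orthonormal (R : realType) (n : nat) (X : complex_manifold R n)
    (k N : nat) (H : 'B(X, k)) (s : 'I_N -> antican_section X k) : Prop :=
  forall i j, H (s i) (s j) = (i == j)%:R.

(* The form for which the basis t is orthonormal; H is a junk value, used when t
   is not a basis. *)
Definition form_of_basis (R : realType) (n : nat) (X : complex_manifold R n)
    (k N : nat) (H : 'B(X, k)) (t : 'I_N -> antican_section X k) : 'B(X, k) :=
  if pselect (exists H' : 'B(X, k), is_orthonormal H' t) is left e
  then projT1 (cid e) else H.

Definition form_of_GL (R : realType) (n : nat) (X : complex_manifold R n)
    (k N : nat) (H0 : 'B(X, k)) (s : 'I_N -> antican_section X k)
    (g : 'M[R[i]]_N) : 'B(X, k) :=
  form_of_basis H0 (fun j => \sum_i g i j *: s i).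

Definition bergman_geodesic (R : realType) (n : nat)
    (X : complex_manifold R n) (k N : nat) (H0 : 'B(X, k))
    (s : 'I_N -> antican_section X k) (A : 'M[R[i]]_N) (t : R) : 'B(X, k) :=
  form_of_GL H0 s (expmx ((2^-1 * t)%:C *: A)).

Definition gram (R : realType) (n : nat) (X : complex_manifold R n)
    (k N : nat) (H : 'B(X, k)) (s : 'I_N -> antican_section X k) : 'M[R[i]]_N :=
  \matrix_(i, j) H (s i) (s j).

(* det(H . H0^-1) is computed in the basis s, but does not depend on it. *)
Definition ding (R : realType) (n : nat) (X : complex_manifold R n)
    (P : subordinate_partition X) (k N : nat) (H0 : 'B(X, k))
    (s : 'I_N -> antican_section X k) (H : 'B(X, k)) : R :=
  (k * N)%:R^-1 * ln (complex.Re (\det (gram H s) / \det (gram H0 s)))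
  - ln (vol_integral P (FS H) (fun=> 1)).

(* Q is the Hessian at H0 of the quantized Ding functional: a symmetric real
   bilinear form on hermitian matrices whose diagonal values are the second
   derivatives along Bergman geodesics.  Such a Q is unique by polarization. *)
Definition is_ding_hessian (R : realType) (n : nat) (X : complex_manifold R n)
    (P : subordinate_partition X) (k N : nat) (H0 : 'B(X, k))
    (s : 'I_N -> antican_section X k) (Q : 'M[R[i]]_N -> 'M[R[i]]_N -> R) : Prop :=
  [/\ {in hermsymmx &, forall A B, Q A B = Q B A},
      {in hermsymmx & &, forall A B C, forall r : R,
         Q (r%:C *: A + B) C = r * Q A C + Q B C} &
      {in hermsymmx, forall A,
         let f t := ding P H0 s (bergman_geodesic H0 s A t) in
         (\forall t \near (0 : R), derivable f t (1 : R)) /\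
         is_derive (0 : R) (1 : R) (derive1 f) (Q A A)}].

(* Real directional derivative of a complex-valued function. *)
Definition Dreal (R : realType) (N : nat) (v : 'rV[R[i]]_N)
    (f : 'rV[R[i]]_N -> R[i]) (w : 'rV[R[i]]_N) : R[i] :=
  derive1 (fun t : R => complex.Re (f (w + t%:C *: v))) 0 +i*
  derive1 (fun t : R => complex.Im (f (w + t%:C *: v))) 0.

(* d/dw_j = (d/dx_j - i d/dy_j) / 2 and d/dwbar_j = (d/dx_j + i d/dy_j) / 2. *)
Definition wirtinger (R : realType) (N : nat) (j : 'I_N)
    (f : 'rV[R[i]]_N -> R[i]) (w : 'rV[R[i]]_N) : R[i] :=
  2^-1 * (Dreal (delta_mx 0 j) f w - 'i * Dreal ('i *: delta_mx 0 j) f w).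

Definition wirtinger_bar (R : realType) (N : nat) (j : 'I_N)
    (f : 'rV[R[i]]_N -> R[i]) (w : 'rV[R[i]]_N) : R[i] :=
  2^-1 * (Dreal (delta_mx 0 j) f w + 'i * Dreal ('i *: delta_mx 0 j) f w).

(* Coefficients g_(i jbar) of the Fubini-Study metric in an affine chart. *)
Definition fs_coef (R : realType) (N : nat) (i j : 'I_N) (w : 'rV[R[i]]_N) :
    R[i] :=
  wirtinger i (wirtinger_bar j
    (fun z => (ln (\sum_l sqnorm (z 0 l)))%:C)) w.

(* xi_A, the push-forward of sum_ij A_ij Z_i d/dZ_j = (Z A)_j d/dZ_j, in the
   affine chart {Z_a != 0}. *)
Definition xi (R : realType) (N : nat) (A : 'M[R[i]]_N) (a : 'I_N)
    (Z : 'rV[R[i]]_N) : 'rV[R[i]]_N :=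
  'D_(Z *m A) (affine a) Z.

(* (xi_A, xi_B)_FS at the point [Z]; the coordinate w_a = 1 is left out. *)
Definition fs_inner (R : realType) (N : nat) (A B : 'M[R[i]]_N)
    (Z : 'rV[R[i]]_N) : R[i] :=
  if [pick a | Z 0 a != 0] is Some a then
    \sum_(i | i != a) \sum_(j | j != a)
      fs_coef i j (affine a Z) * xi A a Z 0 i * (xi B a Z 0 j)^*
  else 0.

Definition momentM (R : realType) (N : nat) (Z : 'rV[R[i]]_N) : 'M[R[i]]_N :=
  \matrix_(a, b) ((Z 0 a)^* * Z 0 b / (\sum_l sqnorm (Z 0 l))%:C).

(* tr(A M) is real for hermitian A. *)
Definition hamiltonian (R : realType) (N : nat) (A : 'M[R[i]]_N)
    (Z : 'rV[R[i]]_N) : R :=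
  complex.Re (\tr (A *m momentM Z)).

(* Main.v *)
(* Diagonalize the hermitian matrix as A = P^* diag(d) P with P unitary.  In the
   coordinates u = Z P^* of the section vector Z(x), the Bergman geodesic in the
   direction A multiplies |u_j|^2 by e^(t d_j), so that the volume form e^(-FS) has
   density (k^(-n) sum_j e^(t d_j) |u_j|^2)^(-1/k), while log det is linear in t.
   The first two logarithmic derivatives of sum_j e^(t d_j) |u_j|^2 at t = 0 are the
   mean and the variance of d for the weights |u_j|^2 / |Z|^2, that is H(A) and
   |xi_A|^2_FS.  The densities along the geodesic are dominated by a multiple of the
   one at t = 0, which is bounded on each compact piece of X; so one may
   differentiate twice under the integral.  Polarization concludes. *)
Require Import Defs.
From HB Require Import structures.
From mathcomp Require Import all_boot all_order all_algebra.
From mathcomp Require Import all_classical all_reals all_analysis.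
From mathcomp Require Import complex.
From mathcomp Require Import spectral measurable_realfun ring lra.

Set Implicit Arguments.
Unset Strict Implicit.
Unset Printing Implicit Defensive.

Import Order.TTheory GRing.Theory Num.Theory.
Import numFieldNormedType.Exports.

Local Open Scope classical_set_scope.
Local Open Scope ring_scope.
Local Open Scope sesquilinear_scope.
Local Open Scope complex_scope.

(** The integrands are not visibly continuous: [fs_inner] picks an affine chart and [proj_coord] a
    chart of X, and both choices jump. Homogeneity removes them. With <u, v> the hermitian product
    of row vectors, Re (xi_A, xi_B)_FS at [Z] equals Re <Z A, Z B> / |Z|^2 - H(A) H(B), where H(A) =
    Re <Z A, Z> / |Z|^2; these expressions have degree 0 in Z and do not see the frame. They are
    therefore continuous on X and integrable, which the bilinearity of the right-hand side requires.
    X carries no measure of its own: integrals are finite sums over images of Borel pieces in C^n,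
    whose measurable structure is an iterated product of real lines. Measurability of these images,
    finiteness of their measure and boundedness of the integrands have to be derived from the
    topology. The bounds used to differentiate under the integral must be uniform in the point of X,
    so they involve the eigenvalues only. With D = sum_j |d_j| and |t| <= 1, each e^(t d_j) is at
    least e^(-D); hence the density at t is at most e^(D/k) times the one at 0, and its
    t-derivatives cost only a factor polynomial in D. *)

(** * Hermitian products of row vectors *)

Section hermitian_forms.
Context {F : numClosedFieldType} {N : nat}.
Implicit Types (u v w Z : 'rV[F]_N) (A B : 'M[F]_N).

Lemma dotmx_sum u v : dotmx u v = \sum_l u 0 l * Num.conj (v 0 l).
Proof. by rewrite dotmxE mxE; apply: eq_bigr => l _; rewrite !mxE. Qed.

Lemma dotmxC u v : dotmx v u = Num.conj (dotmx u v).
Proof.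
rewrite !dotmx_sum rmorph_sum /=; apply: eq_bigr => l _.
by rewrite rmorphM /= conjCK mulrC.
Qed.

Lemma hermsymmx_tr A : A \is hermsymmx -> A = (map_mx Num.conj A)^T.
Proof.
by move=> /is_hermitianmxP; rewrite expr0 scale1r map_trmx.
Qed.

Lemma dotmx_herm A u v : A \is hermsymmx -> dotmx (u *m A) v = dotmx u (v *m A).
Proof.
move=> /hermsymmx_tr hA; rewrite !dotmxE {1}hA -mulmxA; congr ((_ *m _) 0 0).
by rewrite trmx_mul map_mxM /= map_trmx.
Qed.

Lemma dotmx_delta j w : dotmx w (delta_mx 0 j) = w 0 j.
Proof.
rewrite dotmx_sum (bigD1 j) //= big1 ?addr0 => [|l lj]; rewrite mxE !eqxx /=.
  by rewrite rmorph1 mulr1.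
by rewrite (negPf lj) rmorph0 mulr0.
Qed.

(** As [u] and [v] vanish at the index [a], the excluded terms would be zero; over all indices the
    double sum splits into dot products. *)
Lemma fubini_study_sum a (r : F) w u v : u 0 a = 0 -> v 0 a = 0 ->
  \sum_(i | i != a) \sum_(j | j != a)
    ((i == j)%:R / r - Num.conj (w 0 i) * w 0 j / r ^+ 2)
      * u 0 i * Num.conj (v 0 j) =
  dotmx u v / r - dotmx u w * dotmx w v / r ^+ 2.
Proof.
move=> ua va.
transitivity (\sum_i \sum_j ((i == j)%:R / r
    - Num.conj (w 0 i) * w 0 j / r ^+ 2) * u 0 i * Num.conj (v 0 j)).
  rewrite [RHS](bigD1 a)//= [X in _ = X + _]big1 ?add0r => [|j _]; last first.
    by rewrite ua mulr0 mul0r.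
  apply: eq_bigr => i ia; rewrite [RHS](bigD1 a)//= va rmorph0 mulr0 add0r.
  exact: eq_bigr.
rewrite !dotmx_sum !mulr_suml -sumrB; apply: eq_bigr => i _.
under eq_bigr do rewrite !mulrBl.
rewrite sumrB; congr (_ - _).
  rewrite (bigD1 i)//= eqxx big1 ?addr0 => [|j ji].
    by rewrite mul1r; ring.
  by rewrite eq_sym (negPf ji) !mul0r.
by rewrite mulr_sumr mulr_suml; apply: eq_bigr => j _; ring.
Qed.

(* The Fubini-Study form is degenerate along [Z] and of degree 0, hence it takes
   the same value on the lifts [u], [v] as on their affine representatives. *)
Lemma fubini_study_affine (b a0 b0 : F) u v Z : b != 0 -> dotmx Z Z != 0 ->
  dotmx (b *: (u - a0 *: Z)) (b *: (v - b0 *: Z)) / (b * Num.conj b * dotmx Z Z)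
  - dotmx (b *: (u - a0 *: Z)) (b *: Z) * dotmx (b *: Z) (b *: (v - b0 *: Z))
    / (b * Num.conj b * dotmx Z Z) ^+ 2 =
  dotmx u v / dotmx Z Z - dotmx u Z * dotmx Z v / dotmx Z Z ^+ 2.
Proof.
move=> b_neq0 nZ.
have bc : Num.conj b != 0 by rewrite fmorph_eq0.
have dl a x y z :
    dotmx (b *: (x - a *: y)) z = b * (dotmx x z - a * dotmx y z).
  by rewrite linearZl_LR linearBl linearZl_LR.
have dr a x y z : dotmx z (b *: (x - a *: y)) =
    Num.conj b * (dotmx z x - Num.conj a * dotmx z y).
  by rewrite linearZr_LR linearBr linearZr_LR.
have bl x y : dotmx (b *: x) y = b * dotmx x y by rewrite linearZl_LR.
have br x y : dotmx x (b *: y) = Num.conj b * dotmx x y by rewrite linearZr_LR.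
rewrite !dl !dr !bl !br.
by field; rewrite nZ b_neq0 bc.
Qed.

End hermitian_forms.

Section hermitian_products.
Context {R : realType} {N : nat}.
Local Notation C := R[i].
Implicit Types (u v w Z : 'rV[C]_N) (A B : 'M[C]_N).

Lemma mulCconj (z : C) : z * Num.conj z = (sqnorm z)%:C.
Proof. by case: z => a b; rewrite /sqnorm; simpc => /=; congr (_ +i* _); ring. Qed.

Lemma sqnorm_ge0 (z : C) : 0 <= sqnorm z.
Proof. by rewrite addr_ge0 ?sqr_ge0. Qed.

Lemma sqnormM (y z : C) : sqnorm (y * z) = sqnorm y * sqnorm z.
Proof. by case: y z => a b [c d]; rewrite /sqnorm /=; ring. Qed.

Lemma sqnorm_eq0 (z : C) : (sqnorm z == 0) = (z == 0).
Proof.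
case: z => a b; rewrite /sqnorm /= paddr_eq0 ?sqr_ge0 // !sqrf_eq0.
by rewrite eq_complex.
Qed.

Lemma conj_real_complex (r : R) : Num.conj (r%:C : C) = r%:C.
Proof. by apply/eqP; rewrite eq_complex /= oppr0 !eqxx. Qed.

Definition nrm2 u : R := \sum_l sqnorm (u 0 l).

Lemma dotmx_nrm2 u : dotmx u u = (nrm2 u)%:C.
Proof.
rewrite dotmx_sum /nrm2 rmorph_sum; apply: eq_bigr => l _.
exact: mulCconj.
Qed.

Lemma nrm2_ge0 u : 0 <= nrm2 u.
Proof. by apply: sumr_ge0 => l _; exact: sqnorm_ge0. Qed.

Lemma nrm2_eq0 u : (nrm2 u == 0) = (u == 0).
Proof.
apply/idP/idP => [|/eqP ->]; last first.
  by rewrite /nrm2 big1// => l _; rewrite mxE /sqnorm /= expr0n addr0.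
rewrite psumr_eq0; last by move=> l _; exact: sqnorm_ge0.
move=> /allP h; apply/eqP/rowP => l; rewrite mxE; apply/eqP.
by rewrite -sqnorm_eq0; apply: h; rewrite mem_index_enum.
Qed.

Lemma nrm2_gt0 u : (0 < nrm2 u) = (u != 0).
Proof. by rewrite lt0r nrm2_ge0 andbT nrm2_eq0. Qed.

Lemma nrm2D u v : nrm2 (u + v) = nrm2 u + 2 * complex.Re (dotmx u v) + nrm2 v.
Proof.
rewrite dotmx_sum raddf_sum /= mulr_sumr -!big_split /=.
apply: eq_bigr => l _; rewrite mxE; case: (u 0 l) (v 0 l) => a b [c d].
by rewrite /sqnorm /=; ring.
Qed.

Lemma nrm2Z a u : nrm2 (a *: u) = sqnorm a * nrm2 u.
Proof.
by rewrite /nrm2 mulr_sumr; apply: eq_bigr => l _; rewrite mxE sqnormM.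
Qed.

Lemma dotmx_herm_real A u : A \is hermsymmx ->
  dotmx (u *m A) u = (complex.Re (dotmx (u *m A) u))%:C.
Proof.
move=> hA; have := dotmxC u (u *m A); rewrite (dotmx_herm _ _ hA).
case: (dotmx _ _) => a b [] /= ?.
by apply/eqP; rewrite eq_complex /= eqxx /=; lra.
Qed.

(** This Rayleigh quotient is of degree 0 in [Z], unlike the entries of the trace it can be compared
    directly with [fs_inner]. *)
Lemma hamiltonianE A Z :
  hamiltonian A Z = complex.Re (dotmx (Z *m A) Z) / nrm2 Z.
Proof.
have -> : complex.Re (dotmx (Z *m A) Z) / nrm2 Z =
    complex.Re (dotmx (Z *m A) Z * ((nrm2 Z)^-1)%:C).
  by case: (dotmx _ _) => a b /=; rewrite mulr0 subr0.
rewrite /hamiltonian; congr complex.Re.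
rewrite /mxtrace dotmx_sum mulr_suml.
under eq_bigr do rewrite mxE.
rewrite exchange_big /=; apply: eq_bigr => a _; rewrite mxE.
rewrite 2!mulr_suml; apply: eq_bigr => b _; rewrite mxE.
by rewrite -fmorphV /=; ring.
Qed.

End hermitian_products.

(** Closed form of the difference quotient of [affine a] at [Z] along [v]. Its left side still makes
    sense at h = 0 and is continuous there, which yields the derivative defining [xi]. *)
Lemma affine_difference (F : fieldType) N (a : 'I_N) (Z v : 'rV[F]_N) (h : F) :
  h != 0 -> Z 0 a != 0 -> (h *: v + Z) 0 a != 0 ->
  (Z 0 a + h * v 0 a)^-1 *: (v - (v 0 a / Z 0 a) *: Z) =
  h^-1 *: (((h *: v + Z) 0 a)^-1 *: (h *: v + Z) - (Z 0 a)^-1 *: Z).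
Proof.
rewrite !mxE => h0 Za hZ; apply/rowP => i; rewrite !mxE.
by rewrite [h * _ + _]addrC in hZ *; field; rewrite h0 Za hZ.
Qed.

(** * The Fubini-Study product in homogeneous coordinates *)

Section fubini_study.
Context {R : realType} {N : nat}.
Local Notation C := R[i].
Implicit Types (u v w Z : 'rV[C]_N) (A B : 'M[C]_N).

Lemma is_derive_nrm2 w v :
  is_derive (0 : R) (1 : R) (fun t : R => nrm2 (w + t%:C *: v))
    (2 * complex.Re (dotmx w v)).
Proof.
have -> : (fun t : R => nrm2 (w + t%:C *: v)) =
    (fun t => nrm2 w + 2 * complex.Re (dotmx w v) * t + nrm2 v * t ^+ 2).
  apply/funext => t; rewrite nrm2D linearZr_LR nrm2Z /=.
  case: (dotmx w v) => a b.
  by rewrite /sqnorm /=; ring.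
apply: is_derive_eq; rewrite /GRing.scale /=; ring.
Qed.

Lemma Dreal_ln_nrm2 v w : w != 0 ->
  Dreal v (fun z => (ln (\sum_l sqnorm (z 0 l)))%:C) w =
    (2 * complex.Re (dotmx w v) / nrm2 w)%:C.
Proof.
move=> w0; rewrite /Dreal /=; congr (_ +i* _); rewrite derive1E; last first.
  by rewrite derive_cst.
apply: derive_val; rewrite mulrC; apply: is_derive1_comp => //.
  by rewrite scale0r addr0; apply: is_derive1_ln; rewrite nrm2_gt0.
exact: is_derive_nrm2.
Qed.

Lemma wirtinger_bar_ln_nrm2 j w : w != 0 ->
  wirtinger_bar j (fun z => (ln (\sum_l sqnorm (z 0 l)))%:C) w =
    w 0 j / (nrm2 w)%:C.
Proof.
move=> w0; rewrite /wirtinger_bar !Dreal_ln_nrm2 // linearZr_LR /=.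
rewrite dotmx_delta.
have n0 : nrm2 w != 0 by rewrite nrm2_eq0.
case: (w 0 j) => a b; rewrite -fmorphV /=.
(* The complex number 1/2 is written as the image of a real one, so that [simpc] can separate real
   and imaginary parts. *)
rewrite -[2^-1]/((2%:R : C)^-1) -[2%:R](rmorph_nat (real_complex R)) -fmorphV /=.
simpc; congr (_ +i* _); by field.
Qed.

Lemma Dreal_quotient j v w a : w 0 a != 0 -> v 0 a = 0 ->
  Dreal v (wirtinger_bar j (fun z => (ln (\sum_l sqnorm (z 0 l)))%:C)) w =
    (v 0 j - w 0 j * (2 * complex.Re (dotmx w v) / nrm2 w)%:C) / (nrm2 w)%:C.
Proof.
(* The a-th coordinate is constant along [v], so the whole line avoids 0 and [wirtinger_bar_ln_nrm2]
   applies at each of its points. *)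
move=> wa va; have n0 (t : R) : w + t%:C *: v != 0.
  apply: contraNneq wa => /rowP/(_ a).
  by rewrite !mxE va mulr0 addr0 => ->.
have w0 : nrm2 w != 0 by have := n0 0; rewrite scale0r addr0 nrm2_eq0.
have der (x y : R) : is_derive (0 : R) (1 : R)
    (fun t => (x + t * y) * (nrm2 (w + t%:C *: v))^-1)
    (y / nrm2 w - x * (2 * complex.Re (dotmx w v)) / nrm2 w ^+ 2).
  have h := is_derive_nrm2 w v.
  have hV : is_derive (0 : R) (1 : R) (fun t => (nrm2 (w + t%:C *: v))^-1)
      (- (nrm2 w) ^- 2 *: (2 * complex.Re (dotmx w v))).
    have := is_deriveV _ h; rewrite scale0r addr0; exact.
  apply: is_derive_eq; rewrite /= scale0r addr0 /GRing.scale /=.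
  by rewrite !(mul0r, addr0, add0r, mulr0, mulr1); field.
rewrite /Dreal (_ : (fun t : R => complex.Re _) = (fun t =>
  (complex.Re (w 0 j) + t * complex.Re (v 0 j)) * (nrm2 (w + t%:C *: v))^-1)).
  rewrite (_ : (fun t : R => complex.Im _) = (fun t =>
    (complex.Im (w 0 j) + t * complex.Im (v 0 j)) * (nrm2 (w + t%:C *: v))^-1)).
    rewrite !derive1E !(derive_val (is_derive := der _ _)).
    case: (w 0 j) (v 0 j) => x y [z t] /=.
    by rewrite -!fmorphV /=; simpc; congr (_ +i* _); field.
  apply/funext => t; rewrite wirtinger_bar_ln_nrm2 // !mxE -fmorphV /=.
  by case: (w 0 j) (v 0 j) => x y [z t'] /=; ring.
apply/funext => t; rewrite wirtinger_bar_ln_nrm2 // !mxE -fmorphV /=.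
by case: (w 0 j) (v 0 j) => x y [z t'] /=; ring.
Qed.

(** The quotient w_j / |w|^2 is differentiated in the i-th direction; the condition on [i] keeps the
    a-th coordinate, and with it the norm, away from 0. *)
Lemma fs_coefE i j a w : i != a -> w 0 a != 0 ->
  fs_coef i j w = (i == j)%:R / (nrm2 w)%:C
    - Num.conj (w 0 i) * w 0 j / (nrm2 w)%:C ^+ 2.
Proof.
move=> ia wa.
have w0 : nrm2 w != 0.
  by rewrite nrm2_eq0; apply: contraNneq wa => ->; rewrite mxE.
rewrite /fs_coef /wirtinger !(@Dreal_quotient _ _ _ a) // ?mxE;
  rewrite ?(eq_sym a) ?(negPf ia) ?andbF ?mulr0 //.
have -> : dotmx w ('i *: delta_mx 0 i) = Num.conj 'i * w 0 i.
  by rewrite linearZr_LR /= dotmx_delta.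
rewrite dotmx_delta [j == i]eq_sym /=.
rewrite -[2^-1]/((2%:R : C)^-1) -[2%:R](rmorph_nat (real_complex R)).
rewrite -rmorphXn /= -!fmorphV /=.
by case: (w 0 j) (w 0 i) => x y [z t]; case: (i == j) => /=; simpc;
  congr (_ +i* _); field.
Qed.

Lemma xiE A a Z : Z 0 a != 0 ->
  xi A a Z = (Z 0 a)^-1 *: (Z *m A - ((Z *m A) 0 a / Z 0 a) *: Z).
Proof.
move=> Za; rewrite /xi /derive; move: (Z *m A) => v.
apply: (@cvg_lim 'rV[C]_N) => //.
have h0 : (fun h : C => Z 0 a + h * v 0 a) @ 0 --> Z 0 a.
  rewrite -[X in _ --> X]addr0 -[X in _ --> _ + X](mul0r (v 0 a)).
  apply: (@cvgD C C C (nbhs 0) _ (cst (Z 0 a)) (fun h => h * v 0 a)); first exact: (@cvg_cst C).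
  by apply: (@cvgM C C (nbhs 0) _ id); [exact: cvg_id|exact: (@cvg_cst C)].
have : (fun h : C => (Z 0 a + h * v 0 a)^-1 *: (v - (v 0 a / Z 0 a) *: Z)) @ 0^'
    --> (Z 0 a)^-1 *: (v - (v 0 a / Z 0 a) *: Z).
  apply: (@cvgZr_tmp C 'rV[C]_N _ 0^' _ (fun h : C => (Z 0 a + h * v 0 a)^-1)).
  by apply: cvg_within_filter; exact: cvgV.
apply: cvg_trans; apply: near_eq_cvg.
have : \forall h \near (0 : C), Z 0 a + h * v 0 a != 0 by exact: cvgr_neq0 h0 Za.
move=> near0; rewrite near_withinE; near=> h => hN0.
have hZ : Z 0 a + h * v 0 a != 0 by near: h.
by apply: (@affine_difference C) => //; rewrite !mxE addrC.
Unshelve. all: by end_near. Qed.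

(** The index chosen by [pick] disappears, thanks to [fubini_study_affine]. Continuity in the point
    of X is only visible on this form. *)
Lemma fs_inner_dotmx A B Z : Z != 0 ->
  fs_inner A B Z = dotmx (Z *m A) (Z *m B) / (nrm2 Z)%:C
    - dotmx (Z *m A) Z * dotmx Z (Z *m B) / (nrm2 Z)%:C ^+ 2.
Proof.
move=> Z0; rewrite /fs_inner; case: pickP => [a Za|Z00]; last first.
  by case/eqP: Z0; apply/rowP => a; rewrite mxE; apply/eqP; move/negbFE: (Z00 a).
set w := affine a Z.
have wa : w 0 a = 1 by rewrite mxE mulVf.
have xia D : xi D a Z 0 a = 0 by rewrite xiE// !mxE divfK// subrr mulr0.
transitivity (\sum_(i | i != a) \sum_(j | j != a)
    ((i == j)%:R / (nrm2 w)%:C - Num.conj (w 0 i) * w 0 j / (nrm2 w)%:C ^+ 2)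
      * xi A a Z 0 i * Num.conj (xi B a Z 0 j)).
  apply: eq_bigr => i ia; apply: eq_bigr => j _.
  by rewrite (@fs_coefE _ _ a)// wa oner_neq0.
have h := @fubini_study_sum C N a (nrm2 w)%:C w _ _ (xia A) (xia B).
apply: (etrans h).
rewrite -(dotmx_nrm2 w) -(dotmx_nrm2 Z).
rewrite (xiE A Za) (xiE B Za).
have -> : dotmx w w = (Z 0 a)^-1 * Num.conj (Z 0 a)^-1 * dotmx Z Z.
  by rewrite /w /affine linearZl_LR linearZr_LR /= mulrA.
apply: fubini_study_affine; first by rewrite invr_eq0.
by rewrite dotmx_nrm2 fmorph_eq0 nrm2_eq0.
Qed.

(** Product of the velocities Z A and Z B of the lift, normalized by |Z|^2. Subtracting H(A) H(B)
    removes their components along Z and leaves the Fubini-Study product. *)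
Definition velocity_form A B Z : R :=
  complex.Re (dotmx (Z *m A) (Z *m B)) / nrm2 Z.

Lemma Re_quotient (z : C) (a b r : R) : r != 0 ->
  complex.Re (z / r%:C - a%:C * b%:C / r%:C ^+ 2) =
    complex.Re z / r - (a / r) * (b / r).
Proof.
move=> r0; rewrite -rmorphXn -!fmorphV /=; case: z => x y /=.
by rewrite !(mul0r, mulr0, subr0, addr0); field.
Qed.

Lemma Re_fs_inner A B Z : A \is hermsymmx -> B \is hermsymmx -> Z != 0 ->
  complex.Re (fs_inner A B Z) =
    velocity_form A B Z - hamiltonian A Z * hamiltonian B Z.
Proof.
move=> hA hB Z0; rewrite (fs_inner_dotmx A B Z0) -(dotmx_herm Z Z hB).
rewrite (dotmx_herm_real Z hA) (dotmx_herm_real Z hB).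
rewrite (hamiltonianE A) (hamiltonianE B).
by apply: Re_quotient; rewrite nrm2_eq0.
Qed.

End fubini_study.

(** * Continuous maps between R and C *)

Section complex_topology.
Context {R : realType}.
Local Notation C := R[i].

Lemma continuous_real_complex : continuous (fun x : R => x%:C : C).
Proof.
move=> x; apply/(@cvgrPdist_lt C C) => e; rewrite ltcE /= => /andP[/eqP e0 ex].
near=> y; rewrite -rmorphB normc_def /= expr0n addr0 sqrtr_sqr.
rewrite ltcE /= -e0 eqxx /=; near: y.
exact: cvgr_dist_lt.
Unshelve. all: by end_near. Qed.

(** Radii of balls in C are themselves elements of C, so the Lipschitz bound is stated in C and a
    real radius [e] is used as [e%:C]. *)
Lemma continuous_normc_le (f : C -> R) :
  (forall x y, `|f x - f y|%:C <= `|x - y|) -> continuous f.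
Proof.
move=> fle x; apply/(@cvgrPdist_lt R R C (nbhs x)) => e e0.
have eC0 : 0 < e%:C :> C by rewrite ltcR.
have xe : nbhs x (ball x e%:C) by exact: (@nbhsx_ballx C C).
have : nbhs x [set y | `|f x - f y| < e].
  apply: (@filterS C (nbhs x) (nbhs_filter x) _ _ _ xe) => y xy.
  by rewrite /= -ltcR (le_lt_trans (fle _ _)).
exact.
Qed.

Lemma continuous_Re : continuous (fun z : C => complex.Re z : R).
Proof.
by apply: continuous_normc_le => x y; rewrite -raddfB normc_ge_Re.
Qed.

Lemma continuous_Im : continuous (fun z : C => complex.Im z : R).
Proof.
apply: continuous_normc_le => x y; rewrite -raddfB normc_def lecR -sqrtr_sqr.
by rewrite ler_wsqrtr// lerDr sqr_ge0.
Qed.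

End complex_topology.

(** * Spectral calculus and the exponential of hermitian matrices *)

Section unitary_diagonalization.
Context {F : numClosedFieldType} {N : nat}.
Implicit Types (A P : 'M[F]_N) (d e : 'rV[F]_N).

Definition spectral_mx P e : 'M[F]_N := P^t* *m diag_mx e *m P.

Lemma hermsymmx_spectral A : A \is hermsymmx ->
  exists P d, [/\ P \is unitarymx, (forall j, d 0 j \is Num.real) &
    A = spectral_mx P d].
Proof.
move=> hA; exists (spectralmx A), (spectral_diag A); split.
- exact: spectral_unitarymx.
- by move=> j; have /mxOverP := hermitian_spectral_diag_real hA; exact.
rewrite /spectral_mx -invmx_unitary ?spectral_unitarymx//.
by apply/orthomx_spectralP; exact: hermitian_normalmx.
Qed.

Lemma spectral_mxM P d e : P \is unitarymx ->
  spectral_mx P d *m spectral_mx P e = spectral_mx P (\row_j (d 0 j * e 0 j)).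
Proof.
move=> uP; rewrite /spectral_mx !mulmxA mulmxtVK//.
by rewrite -[_ *m diag_mx _ *m diag_mx _]mulmxA mulmx_diag.
Qed.

Lemma spectral_mx1 P : P \is unitarymx -> spectral_mx P (const_mx 1) = 1%:M.
Proof.
move=> uP; rewrite /spectral_mx diag_const_mx mulmx1 -invmx_unitary//.
by rewrite mulVmx// unitarymx_unit.
Qed.

Lemma spectral_mxX P d n : P \is unitarymx ->
  spectral_mx P d ^+ n = spectral_mx P (\row_j d 0 j ^+ n).
Proof.
move=> uP; elim: n => [|n IH].
  rewrite -[LHS](spectral_mx1 uP); congr spectral_mx.
  by apply/rowP => j; rewrite !mxE.
rewrite exprS IH [LHS]spectral_mxM//; congr spectral_mx.
by apply/rowP => j; rewrite !mxE exprS.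
Qed.

(** The matrices on the right do not depend on [e], so sums and limits of spectral matrices reduce
    to those of scalar coefficients. *)
Lemma spectral_mx_sum P e :
  spectral_mx P e = \sum_k e 0 k *: (P^t* *m delta_mx k k *m P).
Proof.
rewrite /spectral_mx diag_mx_sum_delta mulmx_sumr mulmx_suml.
by apply: eq_bigr => k _; rewrite -scalemxAr -scalemxAl.
Qed.

Lemma spectral_mxZ P e a :
  a *: spectral_mx P e = spectral_mx P (a *: e).
Proof.
rewrite !spectral_mx_sum scaler_sumr; apply: eq_bigr => k _.
by rewrite scalerA mxE.
Qed.

Lemma mul_spectral_mx (u : 'rV[F]_N) P e :
  u *m spectral_mx P e = (u *m P^t* *m diag_mx e) *m P.
Proof. by rewrite /spectral_mx !mulmxA. Qed.

Lemma dotmx_unitary (u v : 'rV[F]_N) P : P \is unitarymx ->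
  dotmx (u *m P) (v *m P) = dotmx u v.
Proof.
move=> uP; rewrite !dotmxE trmx_mul map_mxM /= mulmxA mulmxtVK//.
Qed.

Lemma det_spectral_mx P e : P \is unitarymx ->
  \det (spectral_mx P e) = \prod_j e 0 j.
Proof.
move=> uP; rewrite /spectral_mx !det_mulmx det_diag mulrAC -det_mulmx.
by rewrite -invmx_unitary// mulVmx ?unitarymx_unit// det1 mul1r.
Qed.

End unitary_diagonalization.

Section hermitian_exponential.
Context {R : realType} {N : nat}.
Local Notation C := R[i].

Lemma cvg_expR (x : R) : series (exp_coeff x) @ \oo --> expR x.
Proof. exact: (is_cvg_series_exp_coeff x). Qed.

(** Powers act on the eigenvalues, so each partial sum is a combination of fixed matrices with
    partial sums of real exponential series as coefficients. *)
Lemma expmx_spectral (P : 'M[C]_N) (d : 'I_N -> R) : P \is unitarymx ->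
  expmx (spectral_mx P (\row_j (d j)%:C)) =
    spectral_mx P (\row_j (expR (d j))%:C).
Proof.
move=> uP; rewrite /expmx; apply: (@cvg_lim 'M[C]_N) => //.
rewrite [X in X @ _](_ : _ = (fun n => \sum_k
    (series (exp_coeff (d k)) n)%:C *: (P^t* *m delta_mx k k *m P))); last first.
  apply/funext => n; rewrite /series /=.
  under [RHS]eq_bigr do rewrite rmorph_sum scaler_suml.
  rewrite exchange_big /=; apply: eq_bigr => j _.
  rewrite spectral_mxX// spectral_mx_sum scaler_sumr; apply: eq_bigr => k _.
  by rewrite scalerA !mxE /exp_coeff /= rmorphM fmorphV rmorph_nat rmorphXn mulrC.
rewrite spectral_mx_sum; apply: (@cvg_big 'M[C]_N _ +%R).
  exact: add_continuous.
move=> k _; rewrite mxE; apply: (@cvgZr_tmp C 'M[C]_N).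
have h : (fun n => (series (exp_coeff (d k)) n)%:C : C) @ \oo -->
    ((expR (d k))%:C : C).
  exact: (@cvg_comp nat R C _ (fun x : R => x%:C : C) _ (nbhs (expR (d k))) _
    (@cvg_expR (d k)) (@continuous_real_complex R (expR (d k)))).
exact: h.
Qed.

End hermitian_exponential.

(** * Forms with a prescribed orthonormal basis, and their Fubini-Study weights *)

Section dot_products.
Context {R : realType}.
Local Notation C := R[i].

(** Injectivity of [c] gives definiteness. Applied to coordinates in a transformed basis, this
    supplies the form that [form_of_basis] asks for. *)
Lemma dot_pullback (U : lmodType C) N (c : U -> 'rV[C]_N) :
  linear c -> injective c ->
  exists H : {dot U for Num.conj}, forall u v, H u v = dotmx (c u) (c v).
Proof.
move=> lc ic; pose f u v := dotmx (c u) (c v).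
have fl u' : linear_for *%R (f ^~ u').
  by move=> a u v; rewrite /f lc linearDl linearZl_LR.
have fr u : linear_for (Num.conj \; *%R) (f u).
  by move=> a v w; rewrite /f lc linearDr linearZr_LR.
have f0 u : u != 0 -> 0 < f u u.
  move=> u0; rewrite /f dotmx_nrm2 ltcR nrm2_gt0.
  have c0 : c 0 = 0 by have := lc (-1) 0 0; rewrite scaler0 addr0 scaleN1r addNr.
  by apply: contraNneq u0; rewrite -c0 => /ic ->.
have fC u v : f u v = (-1) ^+ false * Num.conj (f v u).
  by rewrite expr0 mul1r /f dotmxC.
pose B := @bilinear_isBilinear.Build C U U C *%R (Num.conj \; *%R) f (fl, fr).
pose Hm := @isHermitianSesquilinear.Build C U false Num.conj f fC.
pose D := @isDotProduct.Build C U f f0.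
pose H : {dot U for Num.conj} := HB.pack f B Hm D.
by exists H.
Qed.

Lemma dot_sum (U : lmodType C) N (H : {dot U for Num.conj}) (t : 'I_N -> U)
    (c e : 'rV[C]_N) : (forall i j, H (t i) (t j) = (i == j)%:R) ->
  H (\sum_j c 0 j *: t j) (\sum_j e 0 j *: t j) = dotmx c e.
Proof.
move=> ot; rewrite dotmx_sum linear_sumlz; apply: eq_bigr => i _.
rewrite linearZl_LR linear_sumr (bigD1 i)//= linearZr_LR /= ot eqxx.
rewrite big1 ?addr0 ?mulr1// => j ji.
by rewrite linearZr_LR /= ot eq_sym (negPf ji) /= mulr0.
Qed.

End dot_products.

Section fubini_study_weight.
Context {R : realType} {n : nat} {X : complex_manifold R n} {k : nat} {N : nat}.
Local Notation C := R[i].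
Implicit Types (H : 'B(X, k)) (s t : 'I_N -> antican_section X k) (g : 'M[C]_N).

Lemma sectionE t (c : 'rV[C]_N) i x :
  (\sum_j c 0 j *: t j) i x = \sum_j c 0 j * t j i x.
Proof.
have E (a : C) (u v : antican_section X k) : (a *: u + v) i x = a * u i x + v i x.
  by [].
have E0 : (0 : antican_section X k) i x = 0 by [].
by elim/big_rec2: _ => [|j v y _ <-]; rewrite ?E0 ?E.
Qed.

Lemma sqnormc_norm (z : C) : (sqnorm z)%:C = `|z| ^+ 2.
Proof. by rewrite -mulCconj sqr_normc. Qed.

Lemma sqnorm_section_le t (c : 'rV[C]_N) i x :
  sqnorm ((\sum_j c 0 j *: t j) i x) <= nrm2 c * nrm2 (hcoord t i x).
Proof.
rewrite sectionE -lecR sqnormc_norm rmorphM /= -!dotmx_nrm2.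
(* [dotmx] conjugates its second argument, whereas evaluation of a section is bilinear; conjugating
   the coordinates reconciles the two. *)
pose b : 'rV[C]_N := map_mx Num.conj (hcoord t i x).
have -> : \sum_j c 0 j * t j i x = dotmx c b.
  by rewrite dotmx_sum; apply: eq_bigr => j _; rewrite !mxE conjCK.
have -> : dotmx (hcoord t i x) (hcoord t i x) = dotmx b b.
  by rewrite !dotmx_sum; apply: eq_bigr => j _; rewrite !mxE conjCK mulrC.
exact: CauchySchwarz.
Qed.

(* By Cauchy-Schwarz the supremum is attained at the section whose coefficients
   are the conjugates of the values [t_j(x)]. *)
Lemma FS_orthonormal H t i x :
  (forall v, exists c : 'rV[C]_N, v = \sum_j c 0 j *: t j) ->
  is_orthonormal H t -> hcoord t i x != 0 ->
  FS H i x = k%:R^-1 * ln (k%:R ^- n * nrm2 (hcoord t i x)).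
Proof.
move=> gent ot tx0; rewrite /FS; congr (_ * ln (_ * _)).
have HE (c : 'rV[C]_N) :
    H (\sum_j c 0 j *: t j) (\sum_j c 0 j *: t j) = (nrm2 c)%:C.
  by rewrite dot_sum// dotmx_nrm2.
set E := [set _ | _ in _].
have ubE : ubound E (nrm2 (hcoord t i x)).
  move=> _ [v /eqP v0 <-]; have [c vE] := gent v.
  have c0 : c != 0.
    apply: contra_notN v0 => /eqP c0; rewrite vE c0 big1// => j _.
    by rewrite mxE scale0r.
  rewrite vE HE /= ler_pdivrMr ?nrm2_gt0// mulrC.
  exact: sqnorm_section_le.
pose b : 'rV[C]_N := map_mx Num.conj (hcoord t i x).
have bE : nrm2 b = nrm2 (hcoord t i x).
  apply: eq_bigr => j _; rewrite !mxE /sqnorm.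
  by case: (t j i x) => y z /=; rewrite sqrrN.
have nt0 : nrm2 (hcoord t i x) != 0 by rewrite nrm2_eq0.
have Et : E (nrm2 (hcoord t i x)).
  exists (\sum_j b 0 j *: t j).
    rewrite /=; apply: contraNneq nt0 => b0; have := HE b; rewrite b0 linear0r bE.
    by move=> /(congr1 (@complex.Re R)) /= <-.
  rewrite HE sectionE /= bE.
  have -> : \sum_j b 0 j * t j i x = (nrm2 (hcoord t i x))%:C.
    rewrite -dotmx_nrm2 dotmx_sum; apply: eq_bigr => j _.
    by rewrite !mxE mulrC.
  by rewrite /sqnorm /= expr0n addr0 expr2 mulfK.
apply/eqP; rewrite eq_le ge_sup//=; last by exists (nrm2 (hcoord t i x)).
by apply: ub_le_sup => //; exists (nrm2 (hcoord t i x)).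
Qed.

Definition change_basis s g : 'I_N -> antican_section X k := fun j => \sum_i g i j *: s i.

Lemma hcoord_change_basis s g i x : hcoord (change_basis s g) i x = hcoord s i x *m g.
Proof.
apply/rowP => j; rewrite !mxE /change_basis.
have := sectionE s (\row_l g l j) i x.
under eq_bigr do rewrite mxE.
move=> ->; apply: eq_bigr => l _; by rewrite !mxE mulrC.
Qed.

Lemma change_basis_gen s g : is_basis s -> g \in unitmx ->
  forall v, exists c : 'rV[C]_N, v = \sum_j c 0 j *: change_basis s g j.
Proof.
move=> bs ug v; have [c [vE _]] := bs v.
(* Coordinates c' in the new basis give coordinates c' g^T in [s]. *)
exists (c *m invmx g^T); rewrite {1}vE.
under [RHS]eq_bigr do rewrite scaler_sumr.
rewrite exchange_big /=; apply: eq_bigr => i _.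
under eq_bigr do rewrite scalerA.
rewrite -scaler_suml; congr (_ *: _).
rewrite -[c in LHS](mulmxKV (_ : g^T \in unitmx)) ?unitmx_tr//.
by rewrite mxE; apply: eq_bigr => j _; rewrite [in X in _ * X]mxE.
Qed.

Lemma orthonormal_coord H s v : is_basis s -> is_orthonormal H s ->
  v = \sum_j H v (s j) *: s j.
Proof.
move=> bs os; have [c [-> _]] := bs v; apply: eq_bigr => j _; congr (_ *: _).
rewrite linear_sumlz (bigD1 j)//= linearZl_LR /= os eqxx mulr1.
by rewrite big1 ?addr0// => l lj; rewrite linearZl_LR /= os (negPf lj) /= mulr0.
Qed.

(** The junk branch of [form_of_basis] is excluded by exhibiting a form: the standard product of the
    coordinates in the transformed basis, read off from products with [s]. *)
Lemma form_of_GL_orthonormal H s g :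
  is_basis s -> is_orthonormal H s -> g \in unitmx ->
  is_orthonormal (form_of_GL H s g) (change_basis s g).
Proof.
move=> bs os ug; rewrite /form_of_GL /form_of_basis.
case: pselect => [e|]; first by case: (cid e).
case; pose c (v : antican_section X k) : 'rV[C]_N := (\row_j H v (s j)) *m invmx g^T.
have ugT : g^T \in unitmx by rewrite unitmx_tr.
have lc : linear c.
  move=> a u v; rewrite /c scalemxAl -mulmxDl; congr (_ *m _).
  by apply/rowP => j; rewrite !mxE linearDl linearZl_LR.
have ic : injective c.
  move=> u v /(congr1 (mulmx^~ g^T)); rewrite /c !mulmxKV// => /rowP uv.
  rewrite [u](orthonormal_coord _ bs os) [v](orthonormal_coord _ bs os).
  by apply: eq_bigr => j _; have := uv j; rewrite !mxE => ->.
have [H' H'E] := dot_pullback lc ic; exists H' => i j.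
have cE l : c (change_basis s g l) = delta_mx 0 l.
  rewrite /c (_ : \row_j _ = delta_mx 0 l *m g^T) ?mulmxK//.
  apply/rowP => m; rewrite -rowE !mxE /change_basis linear_sumlz (bigD1 m)//=.
  rewrite linearZl_LR /= os eqxx mulr1 big1 ?addr0// => p pm.
  by rewrite linearZl_LR /= os (negPf pm) /= mulr0.
rewrite H'E !cE dotmx_sum (bigD1 i)//= big1 ?addr0.
  by rewrite !mxE !eqxx /= mul1r; case: (i == j); rewrite ?rmorph1 ?rmorph0.
by move=> l li; rewrite !mxE (negPf li) andbF mul0r.
Qed.

(** Orthonormality of the transformed basis reads g^T G conj(g) = Id, where G is the Gram matrix of
    [s]; then take determinants. *)
Lemma det_gram H s g : is_orthonormal H (change_basis s g) ->
  \det g * \det (gram H s) * (\det g)^* = 1.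
Proof.
move=> og; rewrite -[X in X * _ * _]det_tr -det_map_mx -!det_mulmx.
rewrite (_ : _ *m _ = 1%:M) ?det1//; apply/matrixP => i j.
transitivity (H (change_basis s g i) (change_basis s g j)); last by rewrite og mxE.
rewrite mxE /change_basis linear_sumlz.
under [LHS]eq_bigr do rewrite mxE mulr_suml.
rewrite exchange_big /=; apply: eq_bigr => m _.
rewrite linearZl_LR linear_sumr mulr_sumr; apply: eq_bigr => l _.
by rewrite linearZr_LR !mxE /= -mulrA [H _ _ * _]mulrC.
Qed.

End fubini_study_weight.

(** * Measurable sets in C^n *)

Section lebesgue_complex_space.
Context {R : realType}.
Local Notation C := R[i].

Lemma measurable_lebC_coord n j :
  measurable_fun setT (fun p : msp_type (lebC R n) => complex.Re (lebC_coord p j)) /\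
  measurable_fun setT (fun p : msp_type (lebC R n) => complex.Im (lebC_coord p j)).
Proof.
elim: n => [|n [IHr IHi]]; first by split; exact: measurable_cst.
rewrite /=; case: (j == n); split.
- exact: (measurableT_comp measurable_snd measurable_fst).
- exact: measurable_snd.
- apply: (measurableT_comp IHr).
  exact: (measurableT_comp measurable_fst measurable_fst).
- apply: (measurableT_comp IHi).
  exact: (measurableT_comp measurable_fst measurable_fst).
Qed.

(** The witness is the box [-M, M]^(2n), built along the recursion that defines [lebC]. *)
Lemma lebC_bounded_finite n (M : R) : exists E : set (msp_type (lebC R n)),
  [/\ measurable E, (msp_measure (lebC R n) E < +oo)%E &
  forall p, (forall j, (j < n)%N -> `|complex.Re (lebC_coord p j)| <= M /\
    `|complex.Im (lebC_coord p j)| <= M) -> E p].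
Proof.
elim: n => [|n [E [mE fE subE]]].
  exists setT; split => //=.
  by rewrite diracT ltry.
pose I := (`[- M, M]%classic : set (measurableTypeR R)).
have mI : measurable I.
  exact: measurable_itv.
have fI : (lebesgue_measure I < +oo)%E.
  by rewrite lebesgue_measure_itv /=; case: ifP => // _; rewrite -EFinB ltry.
exists ((E `*` I) `*` I); split.
- by apply: measurableX => //; exact: measurableX.
- rewrite /= product_measure1E//; last exact: measurableX.
  rewrite /= product_measure1E//.
  have fEI : (msp_measure (lebC R n) E * lebesgue_measure I < +oo)%E.
    by apply: lte_mul_pinfty => //; rewrite ge0_fin_numE.
  apply: lte_mul_pinfty => //; first exact: mule_ge0.
  by rewrite ge0_fin_numE// mule_ge0.
move=> [[p x] y] /= bp; have := bp n; rewrite ltnSn eqxx => /(_ isT)[/= bx by_].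
split; last by rewrite /= /I /= in_itv /= -ler_norml.
split; last by rewrite /= /I /= in_itv /= -ler_norml.
apply: subE => j jn; have := bp j; rewrite ltnS (ltnW jn) => /(_ isT).
by rewrite (ltn_eqF jn).
Qed.

Lemma normc_le_ReIm (z : C) :
  `|z| <= (`|complex.Re z| + `|complex.Im z|)%:C.
Proof.
rewrite normc_def lecR -[leRHS]ger0_norm ?addr_ge0// -sqrtr_sqr ler_wsqrtr//.
rewrite sqrrD !real_normK ?num_real// addrAC lerDl.
by rewrite mulrn_wge0// mulr_ge0.
Qed.

(** Boxes with rational centre and half-width 1/(m+1): a countable family, so that unions of them
    remain measurable. *)
Definition rat_box n (q : {ffun 'I_n -> rat * rat} * nat) : set 'rV[C]_n :=
  [set w | forall j,
     `|complex.Re (w 0 j) - ratr (q.1 j).1| < q.2.+1%:R^-1 /\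
     `|complex.Im (w 0 j) - ratr (q.1 j).2| < q.2.+1%:R^-1].

Lemma rat_near (x : R) m : exists q : rat, `|x - ratr q| < m.+1%:R^-1.
Proof.
have e0 : 0 < m.+1%:R^-1 :> R by rewrite invr_gt0.
have [q] : exists q : rat, ratr q \in `]x - m.+1%:R^-1, x + m.+1%:R^-1[.
  by apply: rat_in_itvoo; rewrite ltrD2l gtrN.
by rewrite in_itv /= -ltr_distlC => xq; exists q.
Qed.

Lemma open_rat_box n (U : set 'rV[C]_n) : open U ->
  U = \bigcup_(q in [set q | rat_box q `<=` U]) rat_box q.
Proof.
move=> oU; apply/seteqP; split => [w Uw|w [q qU qw]]; last exact: qU.
have Uw1 : nbhs w U.   by apply: open_nbhs_nbhs; split.
have /nbhs_ballP[e /= e0 eU] := Uw1.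
(* The radius of a ball over C is a positive complex number, hence real. *)
have eE : e = (complex.Re e)%:C by apply/esym/RRe_real/ger0_real/ltW.
have : 0 < complex.Re e by rewrite -ltcR -eE.
move: (complex.Re e) eE => r eE r0.
(* In one box, two points differ by less than 2/(m+1) in each real and imaginary part, hence by less
   than 4/(m+1) in modulus. *)
pose m := Num.bound (4 / r).
have mr : m.+1%:R^-1 * 4 < r.
  have h : 4 / r < m.+1%:R.
    have := archi_boundP (ltW (divr_gt0 (ltr0n R 4) r0)).
    by move=> /lt_trans; apply; rewrite ltr_nat.
  by rewrite mulrC ltr_pdivrMr// mulrC -ltr_pdivrMr.
have [q qw] := choice (fun j => rat_near (complex.Re (w 0 j)) m).
have [q' qw'] := choice (fun j => rat_near (complex.Im (w 0 j)) m).
exists ([ffun j => (q j, q' j)], m) => /=; last by move=> j /=; rewrite ffunE.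
move=> x xq; apply: eU; split=> // i j; rewrite ord1.
have [xr xi] := xq j; rewrite /= !ffunE /= in xr xi.
have wr := qw j; have wi := qw' j.
change (`|w 0 j - x 0 j| < e).
have dist_lt2 (a b c d : R) : `|a - c| < d -> `|b - c| < d -> `|a - b| < d * 2.
  by rewrite !ltr_norml => /andP[? ?] /andP[? ?]; apply/andP; split; lra.
rewrite (le_lt_trans (normc_le_ReIm _))// eE ltcR !raddfB /=.
have := dist_lt2 _ _ _ _ wr xr; have := dist_lt2 _ _ _ _ wi xi.
move: mr; move: `|_| `|_| (_^-1) => u v d; lra.
Qed.

(** The sigma-algebra of [lebC] is not defined from the topology of row vectors. An open set is a
    countable union of rational boxes, each cut out by finitely many conditions on measurable
    coordinates. *)
Lemma measurable_lebC_point n (U : set 'rV[C]_n) : open U ->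
  measurable (@lebC_point R n @^-1` U).
Proof.
move=> /open_rat_box ->; rewrite preimage_bigcup bigcup_mkcond.
apply: countable_bigcupT_measurable; first exact: countableP.
move=> q; case: ifP => // _.
rewrite (_ : _ @^-1` _ = \bigcap_(j in [set: 'I_n])
   ((fun p => `|complex.Re (lebC_coord p j) - ratr (q.1 j).1|) @^-1`
       `]-oo, q.2.+1%:R^-1[ `&`
    (fun p => `|complex.Im (lebC_coord p j) - ratr (q.1 j).2|) @^-1`
       `]-oo, q.2.+1%:R^-1[)).
  apply: fin_bigcap_measurable; first exact: finite_finset.
  move=> j _; have [mr mi] := measurable_lebC_coord n j.
  apply: measurableI; rewrite -[X in measurable X]setTI.
    apply: (measurableT_comp (@normr_measurable _ _)
      (measurable_funB mr (measurable_cst _))) => //.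
  apply: (measurableT_comp (@normr_measurable _ _)
      (measurable_funB mi (measurable_cst _))) => //.
apply/seteqP; split => p /=.
  by move=> h j _; have := h j; rewrite !mxE /= !in_itv /=.
by move=> h j; have := h j I; rewrite !mxE /= !in_itv /=.
Qed.

End lebesgue_complex_space.

(** * Integrability on the pieces of the partition *)

Section chart_integrability.
Context {R : realType} {n : nat} {X : complex_manifold R n}.
Local Notation C := R[i].
Implicit Types (i : mindex X) (F : X -> R).

Lemma open_chart_preimage i (B : set X) : open B ->
  open ((mchart i @` mdom i) `&` (mparam i @^-1` B)).
Proof.
move=> oB; rewrite openE => w [Ow Bw].
apply: filterI; first by apply: open_nbhs_nbhs; split; [exact: open_mchart|].
by apply: (continuous_mparam Ow); apply: open_nbhs_nbhs; split.
Qed.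

(** Good-set argument: the sets whose preimage under [mparam i], cut by the chart image, is
    measurable form a sigma-algebra containing the open sets. The cut is there because [mparam i] is
    junk off the chart image. *)
Lemma measurable_chart_image i (B : set X) :
  <<s [set U : set X | open U] >> B -> B `<=` mdom i ->
  measurable (@lebC_point R n @^-1` (mchart i @` B)).
Proof.
move=> sB Bi; pose O := mchart i @` @mdom R n X i.
have mO : measurable (@lebC_point R n @^-1` O).
  by apply: measurable_lebC_point; exact: open_mchart.
have -> : mchart i @` B = O `&` (mparam i @^-1` B).
  apply/seteqP; split => [_ [x Bx <-]|w [[x ix <-]]].
    by split; [exists x => //; exact: Bi|rewrite /= mchartK//; exact: Bi].
  by rewrite /= mchartK// => Bx; exists x.
pose G := [set B : set X | measurable (@lebC_point R n @^-1` (O `&` (mparam i @^-1` B)))].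
suff : <<s [set U : set X | open U] >> `<=` G by exact.
apply: smallest_sub => [|U oU]; last first.
  by apply: measurable_lebC_point; exact: open_chart_preimage.
split.
- by rewrite /G /= preimage_set0 setI0 preimage_set0; exact: measurable0.
- move=> A GA; rewrite /G /= setTD.
  have -> : @lebC_point R n @^-1` (O `&` mparam i @^-1` (~` A)) =
    (@lebC_point R n @^-1` O) `\` (@lebC_point R n @^-1` (O `&` mparam i @^-1` A)).
    by apply/seteqP; split => p /=; [move=> [? nA]; split => // -[]
      |move=> [Op nA]; split => // ?; apply: nA].
  exact: measurableD.
- move=> A GA; rewrite /G /= preimage_bigcup setI_bigcupr preimage_bigcup.
  by apply: bigcup_measurable => j _; exact: GA.
Qed.

Lemma measurable_chart_fun i F (D : set (msp_type (lebC R n))) :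
  (forall x, mdom i x -> {for x, continuous F}) ->
  measurable D -> D `<=` @lebC_point R n @^-1` (mchart i @` mdom i) ->
  measurable_fun D (fun p => F (mparam i (lebC_point p))).
Proof.
move=> cF mD DO; have mO : forall B : set R, open B -> measurable (@lebC_point R n @^-1`
    ((mchart i @` @mdom R n X i) `&` (mparam i @^-1` (F @^-1` B)))).
  move=> B oB; apply: measurable_lebC_point; rewrite openE => w [Ow Bw].
  apply: filterI; first by apply: open_nbhs_nbhs; split; [exact: open_mchart|].
  case: Ow Bw => x ix <-; rewrite /preimage /= mchartK// => Bx.
  have cm : (F \o mparam i) @ mchart i x --> F x.
    apply: cvg_comp; first by apply: continuous_mparam; exists x.
    by rewrite mchartK//; exact: cF.
  by apply: cm; apply: open_nbhs_nbhs; split.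
apply: (measurability _ (RGenOpens.measurableE R)) => // _ [_ [a [b ->] <-]].
have := measurableI _ _ mD (mO _ (itv_open a b)).
congr measurable; apply/seteqP; split => q /= [Dq]; first by move=> [].
by move=> Fq; split => //; split => //; exact: DO.
Qed.

End chart_integrability.

Section partition_pieces.
Context {R : realType} {n : nat} {X : complex_manifold R n}.
Context (P : subordinate_partition X).
Hypothesis cX : compact [set: X].
Local Notation C := R[i].
Implicit Types (p : 'I_(psize P)) (F : X -> R).

Definition piece_dom p : set (msp_type (lebC R n)) :=
  @lebC_point R n @^-1` (mchart (pchart p) @` piece p).

Lemma piece_mdom p : piece p `<=` mdom (pchart p).
Proof. by apply: subset_trans (@closure_piece _ _ _ P p); exact: subset_closure. Qed.

Lemma measurable_piece_dom p : measurable (piece_dom p).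
Proof.
apply: measurable_chart_image; first exact: borel_piece.
exact: piece_mdom.
Qed.

(** The closure of the piece is compact and, by [closure_piece], still inside the chart domain where
    [F] is continuous. *)
Lemma continuous_bounded_on_piece p F :
  (forall x, mdom (pchart p) x -> {for x, continuous F}) ->
  exists M, forall x, piece p x -> `|F x| <= M.
Proof.
move=> cF.
have cK : compact (closure (piece p)).
  by apply: (subclosed_compact _ cX) => //; exact: closed_closure.
have : compact (F @` closure (piece p)).
  apply: continuous_compact => //; apply: continuous_in_subspaceT => x.
  by rewrite inE => /closure_piece; exact: cF.
move=> /compact_bounded[M [_ HM]]; exists (M + 1) => x px.
apply: HM; first by rewrite ltrDl.
by exists x => //; exact: subset_closure.
Qed.

Lemma piece_dom_finite p : (msp_measure (lebC R n) (piece_dom p) < +oo)%E.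
Proof.
pose i := pchart p.
(* One continuous function that dominates all 2n real coordinates: a bound for it places the image
   of the piece in a box. *)
pose F (x : X) : R := \sum_j (`|complex.Re (mchart i x 0 j)|
  + `|complex.Im (mchart i x 0 j)|).
have cF x : mdom i x -> {for x, continuous F}.
  move=> ix; apply: (@cvg_big R^o _ +%R); first exact: add_continuous.
  move=> j _.
  have cj : (fun x => mchart i x 0 j) @ x --> mchart i x 0 j.
    apply: (@cvg_comp _ _ _ (mchart i) (fun w : 'rV[C]_n => w 0 j)).
      exact: continuous_mchart.
    exact: coord_continuous.
  have cr : (fun x => complex.Re (mchart i x 0 j)) @ x -->
      complex.Re (mchart i x 0 j).
    exact: (cvg_comp _ _ cj (@continuous_Re R _)).
  have ci : (fun x => complex.Im (mchart i x 0 j)) @ x -->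
      complex.Im (mchart i x 0 j).
    exact: (cvg_comp _ _ cj (@continuous_Im R _)).
  by apply: cvgD; exact: cvg_norm.
have [M FM] := continuous_bounded_on_piece cF.
have [E [mE fE subE]] := lebC_bounded_finite n M.
apply: le_lt_trans fE; apply: le_measure; rewrite ?inE//.
  exact: measurable_piece_dom.
move=> q [x px xq]; apply: subE => j jn.
have -> : lebC_coord q j = mchart i x 0 (Ordinal jn) by rewrite xq mxE.
have := FM _ px; rewrite /F (bigD1 (Ordinal jn))//= ger0_norm; last first.
  by rewrite !addr_ge0// sumr_ge0// => l _; rewrite addr_ge0.
have : 0 <= \sum_(l | l != Ordinal jn) (`|complex.Re (mchart i x 0 l)|
  + `|complex.Im (mchart i x 0 l)|) by rewrite sumr_ge0// => l _; rewrite addr_ge0.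
have := normr_ge0 (complex.Re (mchart i x 0 (Ordinal jn))).
have := normr_ge0 (complex.Im (mchart i x 0 (Ordinal jn))).
by move=> *; split; lra.
Qed.

Lemma integrable_piece p F :
  (forall x, mdom (pchart p) x -> {for x, continuous F}) ->
  (msp_measure (lebC R n)).-integrable (piece_dom p)
    (EFin \o (fun q => F (mparam (pchart p) (lebC_point q)))).
Proof.
move=> cF; have [M FM] := continuous_bounded_on_piece cF.
apply: measurable_bounded_integrable.
- exact: measurable_piece_dom.
- exact: piece_dom_finite.
- apply: measurable_chart_fun => //; first exact: measurable_piece_dom.
  by move=> q [x px xq]; exists x => //; exact: piece_mdom.
exists M; split; first exact: num_real.
move=> y My q [x px xq] /=; rewrite -xq mchartK; last exact: piece_mdom.
by rewrite (le_trans (FM _ px))// ltW.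
Qed.

End partition_pieces.

(** * Exponential sums, their powers, and bounds on two derivatives *)

Section exponential_sums.
Context {R : realType} {N : nat}.
Variables (d m : 'I_N -> R).

(** The a-th derivative of sum_j e^(t d_j) m_j. Divided by [expsum 0 t], it is the a-th moment of
    [d] for the weights e^(t d_j) m_j. *)
Definition expsum (a : nat) (t : R) : R :=
  \sum_j d j ^+ a * (expR (t * d j) * m j).

Lemma is_derive_expsum a (t : R) : is_derive t (1 : R) (expsum a) (expsum a.+1 t).
Proof.
have -> : expsum a = \sum_j (fun t => d j ^+ a * (expR (t * d j) * m j)).
  by apply/funext => u; rewrite fct_sumE.
apply: is_derive_sum => j.
have h : is_derive t (1 : R) (fun u : R => expR (u * d j)) (expR (t * d j) * d j).
  apply: is_derive1_comp; apply: is_derive_eq.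
  by rewrite /GRing.scale /= mulr0 add0r mulr1.
have -> : (fun u => d j ^+ a * (expR (u * d j) * m j)) =
    (fun u => (d j ^+ a * m j) * expR (u * d j)).
  by apply/funext => u; ring.
by apply: is_derive_eq; rewrite /GRing.scale /= exprS; ring.
Qed.

Hypothesis m_ge0 : forall j, 0 <= m j.
Hypothesis m_gt0 : 0 < \sum_j m j.
(** A crude common bound for the |d_j|. It is independent of [m], the only datum that will vary with
    the point of X. *)
Let D := \sum_j `|d j|.

Lemma expsum_gt0 t : 0 < expsum 0 t.
Proof.
have [j _ mj] : exists2 j, true & m j != 0.
  apply/exists_inP; apply: contraTT m_gt0 => /exists_inPn h.
  by rewrite big1 ?ltxx// => j _; apply/eqP; have := h j isT; rewrite negbK.
rewrite /expsum (bigD1 j)//= ltr_wpDr//.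
  by apply: sumr_ge0 => l _; rewrite expr0 mul1r mulr_ge0// expR_ge0.
by rewrite expr0 mul1r mulr_gt0 ?expR_gt0// lt0r mj m_ge0.
Qed.

Lemma norm_le_D j : `|d j| <= D.
Proof. by rewrite /D (bigD1 j)//= lerDl sumr_ge0. Qed.

Lemma expsum_bound a t : `|expsum a t| <= D ^+ a * expsum 0 t.
Proof.
rewrite /expsum mulr_sumr (le_trans (ler_norm_sum _ _ _))//.
apply: ler_sum => j _; rewrite normrM normrX expr0 mul1r.
have h : 0 <= expR (t * d j) * m j by rewrite mulr_ge0// expR_ge0.
by rewrite (ger0_norm h) ler_wpM2r// lerXn2r ?nnegrE ?sumr_ge0// norm_le_D.
Qed.

(** A lower bound on the sum is what matters, because [weight] is a negative power of it. *)
Lemma expsum_ge t : `|t| <= 1 -> expR (- D) * expsum 0 0 <= expsum 0 t.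
Proof.
move=> t1; rewrite /expsum mulr_sumr; apply: ler_sum => j _.
rewrite !expr0 !mul1r mul0r expR0 mul1r ler_wpM2r// ler_expR.
have : `|t * d j| <= D.
  by rewrite normrM (le_trans _ (norm_le_D j))// ler_piMl.
by rewrite ler_norml => /andP[].
Qed.

Variables (q c : R).
Hypotheses (q_ge0 : 0 <= q) (c_gt0 : 0 < c).

(** The power (c * expsum 0 t)^(-q); it is e^(-FS) along a geodesic when q = 1/k and c = k^(-n). *)
Definition weight (t : R) : R := expR (- (q * ln (c * expsum 0 t))).

Definition weight1 (t : R) : R := - (q * (expsum 1 t / expsum 0 t)) * weight t.

(** Arranged to isolate the squared mean and the variance of [d], which become H(A)^2 and |xi_A|^2
    at t = 0. *)
Definition weight2 (t : R) : R :=
  (q ^+ 2 * (expsum 1 t / expsum 0 t) ^+ 2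
   - q * (expsum 2 t / expsum 0 t - (expsum 1 t / expsum 0 t) ^+ 2)) * weight t.

Lemma is_derive_weight (t : R) : is_derive t (1 : R) weight (weight1 t).
Proof.
have s0 := expsum_gt0 t; have h := is_derive_expsum 0 t.
have hc : is_derive t (1 : R) (fun u => c * expsum 0 u) (c * expsum 1 t).
  by apply: is_derive_eq; rewrite /GRing.scale /=; ring.
have hl : is_derive t (1 : R) (fun u => ln (c * expsum 0 u))
    ((c * expsum 0 t)^-1 * (c * expsum 1 t)).
  by apply: is_derive1_comp; apply: is_derive1_ln; rewrite mulr_gt0.
have hn : is_derive t (1 : R) (fun u => - (q * ln (c * expsum 0 u)))
    (- (q * (expsum 1 t / expsum 0 t))).
  apply: is_derive_eq; rewrite /GRing.scale /=; field.
  by rewrite !gt_eqF.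
by apply: is_derive_eq; rewrite /GRing.scale /= /weight1 /weight; ring.
Qed.

Lemma is_derive_weight1 (t : R) : is_derive t (1 : R) weight1 (weight2 t).
Proof.
have s0 := expsum_gt0 t.
have h0 := is_derive_expsum 0 t; have h1 := is_derive_expsum 1 t.
have hV := is_deriveV (lt0r_neq0 s0) h0.
have hw := is_derive_weight t.
rewrite /weight1; apply: is_derive_eq.
rewrite /GRing.scale /= /weight2 /weight1; field.
by rewrite gt_eqF.
Qed.

Lemma weight_ge0 t : 0 <= weight t.
Proof. exact: expR_ge0. Qed.

(** The constant depends neither on [t] nor on [m], so a multiple of [weight 0] can serve as a
    dominating function. *)
Lemma weight_le t : `|t| <= 1 -> weight t <= expR (q * D) * weight 0.
Proof.
move=> t1; rewrite /weight -expRD ler_expR.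
have h : - D + ln (c * expsum 0 0) <= ln (c * expsum 0 t).
  have -> : - D + ln (c * expsum 0 0) = ln (c * (expR (- D) * expsum 0 0)).
    by rewrite mulrCA [in RHS]lnM ?posrE ?mulr_gt0 ?expR_gt0 ?expsum_gt0// expRK.
  rewrite ler_ln ?posrE ?mulr_gt0 ?expR_gt0 ?expsum_gt0//.
  by rewrite ler_pM2l//; exact: expsum_ge.
rewrite -lerN2 opprD !opprK -mulrN -mulrDr.
by rewrite ler_wpM2l.
Qed.

Lemma weight1_bound t : `|weight1 t| <= q * D * weight t.
Proof.
rewrite normrM (ger0_norm (weight_ge0 t)) normrN normrM (ger0_norm q_ge0).
rewrite -!mulrA ler_wpM2l// ler_wpM2r ?weight_ge0//.
rewrite normrM normfV (gtr0_norm (expsum_gt0 t)) ler_pdivrMr ?expsum_gt0//.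
exact: (expsum_bound 1 t).
Qed.

Lemma weight2_bound t :
  `|weight2 t| <= (q ^+ 2 * D ^+ 2 + q * (D ^+ 2 + D ^+ 2)) * weight t.
Proof.
rewrite normrM (ger0_norm (weight_ge0 t)) ler_wpM2r ?weight_ge0//.
have b a : `|expsum a t / expsum 0 t| <= D ^+ a.
  rewrite normrM normfV (gtr0_norm (expsum_gt0 t)) ler_pdivrMr ?expsum_gt0//.
  exact: expsum_bound.
have b1 : `|(expsum 1 t / expsum 0 t) ^+ 2| <= D ^+ 2.
  by rewrite normrX lerXn2r ?nnegrE ?sumr_ge0// (b 1%N).
rewrite (le_trans (ler_normB _ _))// lerD//.
  by rewrite normrM normrX (ger0_norm q_ge0) ler_wpM2l// sqr_ge0.
rewrite normrM (ger0_norm q_ge0) ler_wpM2l//.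
by rewrite (le_trans (ler_normB _ _))// lerD// b.
Qed.

End exponential_sums.

(** * Sections in local frames: non-vanishing and continuity *)

Section sections.
Context {R : realType} {n : nat} {X : complex_manifold R n} {k N : nat}.
Local Notation C := R[i].
Implicit Types (s : 'I_N -> antican_section X k) (A B : 'M[C]_N).

Lemma hcoord_chart s i x : mdom i x ->
  proj_coord s x = jac i (chart_at x) x ^+ k *: hcoord s i x.
Proof.
move=> ix; apply/rowP => j; rewrite !mxE.
by have /section_predP[_ tr _] := sec_funP (s j); apply: tr => //;
  exact: mdom_chart_at.
Qed.

(** Very ampleness only provides some basis [s'], possibly another one. If all s_j vanished at [x],
    so would every section, in particular every s'_j. *)
Lemma hcoord_neq0 s i x : is_basis s -> very_ample X k -> mdom i x ->
  hcoord s i x != 0.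
Proof.
move=> bs [N' [s' [_ [s'0 _ _]]]] ix.
apply: contraNneq (s'0 x) => Z0; apply/eqP/rowP => j; rewrite !mxE.
have [c [-> _]] := bs (s' j); rewrite sectionE big1// => l _.
have := hcoord_chart s ix; rewrite Z0 scaler0 => /rowP/(_ l).
by rewrite !mxE => ->; rewrite mulr0.
Qed.

Lemma continuous_mdom_eq (T : topologicalType) i x (F G : X -> T) : mdom i x ->
  (forall y, mdom i y -> F y = G y) -> {for x, continuous G} ->
  {for x, continuous F}.
Proof.
move=> ix FG cG; rewrite /prop_for /continuous_at (FG _ ix).
apply: cvg_trans cG; apply: near_eq_cvg.
have nx : nbhs x (mdom i) by apply: open_nbhs_nbhs; split; [exact: open_mdom|].
by apply: filterS nx => y iy; rewrite (FG _ iy).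
Qed.

Lemma continuous_section (f : antican_section X k) i x : mdom i x ->
  {for x, continuous (fun y => f i y : C)}.
Proof.
move=> ix; have /section_predP[df _ _] := sec_funP f.
apply: (@continuous_mdom_eq _ i x _ ((f i \o mparam i) \o mchart i)) => //.
  by move=> y iy /=; rewrite mchartK.
apply: (@continuous_comp _ _ _ (mchart i)); first exact: continuous_mchart.
apply: (@differentiable_continuous C 'rV[C]_n C).
by apply: df; exists x.
Qed.

Lemma continuous_hcoord_mul s A i x j : mdom i x ->
  {for x, continuous (fun y => (hcoord s i y *m A) 0 j : C)}.
Proof.
move=> ix.
have -> : (fun y => (hcoord s i y *m A) 0 j) =
    (fun y => \sum_l (s l i y * A l j : C)).
  by apply/funext => y; rewrite mxE; apply: eq_bigr => l _; rewrite mxE.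
apply: (@cvg_big C _ +%R); first exact: (@add_continuous C).
move=> l _; apply: (@cvgM C); last exact: cvg_cst.
exact: continuous_section.
Qed.

Lemma Re_dotmx (u v : 'rV[C]_N) : complex.Re (dotmx u v) =
  \sum_j (complex.Re (u 0 j) * complex.Re (v 0 j)
    + complex.Im (u 0 j) * complex.Im (v 0 j)).
Proof.
rewrite dotmx_sum raddf_sum; apply: eq_bigr => j _.
by case: (u 0 j) (v 0 j) => a b [c e] /=; ring.
Qed.

Lemma continuous_dotmx s A B i x : mdom i x -> {for x, continuous
  (fun y => complex.Re (dotmx (hcoord s i y *m A) (hcoord s i y *m B)) : R)}.
Proof.
move=> ix.
have -> : (fun y => complex.Re (dotmx (hcoord s i y *m A) (hcoord s i y *m B))) =
  (fun y => \sum_j (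
    complex.Re ((hcoord s i y *m A) 0 j) * complex.Re ((hcoord s i y *m B) 0 j)
    + complex.Im ((hcoord s i y *m A) 0 j) * complex.Im ((hcoord s i y *m B) 0 j))).
  by apply/funext => y; rewrite Re_dotmx.
apply: (@cvg_big R^o _ +%R); first exact: (@add_continuous R^o).
move=> j _.
have hR D : {for x, continuous (fun y => complex.Re ((hcoord s i y *m D) 0 j) : R)}.
  apply: (@continuous_comp _ _ _ (fun y => (hcoord s i y *m D) 0 j : C) (@complex.Re R)).
    exact: continuous_hcoord_mul.
  exact: continuous_Re.
have hI D : {for x, continuous (fun y => complex.Im ((hcoord s i y *m D) 0 j) : R)}.
  apply: (@continuous_comp _ _ _ (fun y => (hcoord s i y *m D) 0 j : C) (@complex.Im R)).
    exact: continuous_hcoord_mul.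
  exact: continuous_Im.
apply: (@cvgD R R^o); apply: (@cvgM R); first [exact: hR|exact: hI].
Qed.

End sections.

(** * Bergman geodesics in an eigenbasis *)

Section bergman_geodesics.
Context {R : realType} {n : nat} {X : complex_manifold R n} {k N : nat}.
Context (H0 : 'B(X, k)) (s : 'I_N -> antican_section X k).
Local Notation C := R[i].
Hypotheses (bs : is_basis s) (os : is_orthonormal H0 s) (va : very_ample X k).
Variables (P : 'M[C]_N) (d : 'I_N -> R).
Hypothesis uP : P \is unitarymx.

Let A : 'M[C]_N := spectral_mx P (\row_j (d j)%:C).

Definition geodesic_mx (t : R) : 'M[C]_N :=
  spectral_mx P (\row_j (expR (2^-1 * t * d j))%:C).

Lemma expmx_geodesic t : expmx ((2^-1 * t)%:C *: A) = geodesic_mx t.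
Proof.
have E : (2^-1 * t)%:C *: (\row_j (d j)%:C) = \row_j (2^-1 * t * d j)%:C :> 'rV[C]_N.
  by apply/rowP => j; rewrite !mxE -rmorphM.
by rewrite spectral_mxZ E expmx_spectral.
Qed.

Lemma det_geodesic_mx t :
  \det (geodesic_mx t) = (expR (2^-1 * t * \sum_j d j))%:C.
Proof.
rewrite det_spectral_mx// mulr_sumr expR_sum rmorph_prod.
by apply: eq_bigr => j _; rewrite mxE.
Qed.

Lemma geodesic_mx_unit t : geodesic_mx t \in unitmx.
Proof. by rewrite unitmxE det_geodesic_mx unitfE fmorph_eq0 gt_eqF ?expR_gt0. Qed.

Lemma geodesic_orthonormal t :
  is_orthonormal (bergman_geodesic H0 s A t) (change_basis s (geodesic_mx t)).
Proof.
rewrite /bergman_geodesic expmx_geodesic.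
by apply: form_of_GL_orthonormal => //; exact: geodesic_mx_unit.
Qed.

(* Squared moduli of the coordinates of [s_1 : ... : s_N] in an eigenbasis of A:
   in terms of them the Bergman geodesic acts by the factors e^(t d_j). *)
Definition eigen_mass (i : mindex X) (x : X) (j : 'I_N) : R :=
  sqnorm ((hcoord s i x *m P^t*) 0 j).

Lemma eigen_mass_ge0 i x j : 0 <= eigen_mass i x j.
Proof. exact: sqnorm_ge0. Qed.

Lemma nrm2_unitary (u : 'rV[C]_N) : nrm2 (u *m P) = nrm2 u.
Proof.
have := dotmx_unitary u u uP; rewrite !dotmx_nrm2.
by move=> /(congr1 (@complex.Re R)).
Qed.

Lemma sum_eigen_mass i x : \sum_j eigen_mass i x j = nrm2 (hcoord s i x).
Proof.
rewrite -[RHS](_ : nrm2 (hcoord s i x *m P^t*) = _)//.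
have := nrm2_unitary (hcoord s i x *m P^t*).
by rewrite -mulmxA -invmx_unitary// mulVmx ?unitarymx_unit// mulmx1.
Qed.

(** Each eigencoordinate is multiplied by e^(t d_j / 2); the squared modulus undoes the factor 1/2
    of the parametrization, and the last factor [P] preserves the norm. *)
Lemma nrm2_geodesic i x t :
  nrm2 (hcoord s i x *m geodesic_mx t) = expsum d (eigen_mass i x) 0 t.
Proof.
rewrite mul_spectral_mx nrm2_unitary; apply: eq_bigr => j _.
rewrite mul_mx_diag !mxE sqnormM mulrC expr0 mul1r /eigen_mass mxE.
congr (_ * _); rewrite /sqnorm /= expr0n addr0 -expRM_natl.
by congr expR; field.
Qed.

Lemma sum_eigen_mass_gt0 i x : mdom i x -> 0 < \sum_j eigen_mass i x j.
Proof. by move=> ix; rewrite sum_eigen_mass nrm2_gt0; exact: hcoord_neq0. Qed.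

Lemma FS_geodesic t i x : mdom i x -> FS (bergman_geodesic H0 s A t) i x =
  k%:R^-1 * ln (k%:R ^- n * expsum d (eigen_mass i x) 0 t).
Proof.
move=> ix; rewrite (FS_orthonormal (t := change_basis s (geodesic_mx t))).
- by rewrite hcoord_change_basis nrm2_geodesic.
- exact: change_basis_gen bs (geodesic_mx_unit t).
- exact: geodesic_orthonormal.
rewrite hcoord_change_basis -nrm2_gt0 nrm2_geodesic; apply: expsum_gt0.
  exact: eigen_mass_ge0.
exact: sum_eigen_mass_gt0.
Qed.

Lemma FS_basepoint i x : mdom i x ->
  FS H0 i x = k%:R^-1 * ln (k%:R ^- n * nrm2 (hcoord s i x)).
Proof.
move=> ix; apply: FS_orthonormal => //; last exact: hcoord_neq0.
by move=> v; have [c [vE _]] := bs v; exists c.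
Qed.

(** By [det_gram] the determinant is det(g(t))^(-2), with det g(t) = e^(t tr(A) / 2). *)
Lemma det_gram_geodesic t :
  ln (complex.Re (\det (gram (bergman_geodesic H0 s A t) s) / \det (gram H0 s)))
    = - (t * \sum_j d j).
Proof.
have -> : gram H0 s = 1%:M.
  by apply/matrixP => i j; rewrite !mxE os.
have := det_gram (geodesic_orthonormal t); rewrite det_geodesic_mx det1 divr1.
set e := expR _; set D := \det _.
rewrite conj_real_complex.
have e0 : e%:C != 0 :> C by rewrite fmorph_eq0 gt_eqF ?expR_gt0.
move=> h; have -> : D = (e ^- 2)%:C.
  rewrite fmorphV rmorphXn /=; apply: (mulfI e0); apply: (mulIf e0).
  by rewrite h; field.
rewrite /= lnV ?posrE ?exprn_gt0 ?expR_gt0// /e -expRM_natl expRK.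
by congr (- _); field.
Qed.

Lemma nrm2_moment1 i x :
  complex.Re (dotmx (hcoord s i x *m A) (hcoord s i x)) =
  expsum d (eigen_mass i x) 1 0.
Proof.
set Z := hcoord s i x.
(* The identity is inserted as a spectral matrix so that both arguments end with [P] and unitary
   invariance applies. *)
rewrite -[X in dotmx _ X]mulmx1 -(spectral_mx1 uP) !mul_spectral_mx dotmx_unitary//.
rewrite dotmx_sum raddf_sum; apply: eq_bigr => j _.
rewrite !mul_mx_diag !mxE mulr1 expr1 mul0r expR0 mul1r /eigen_mass mxE.
set u := \sum_l _; rewrite mulrAC mulCconj.
by rewrite /= mulr0 subr0 mulrC.
Qed.

Lemma nrm2_moment2 i x :
  complex.Re (dotmx (hcoord s i x *m A) (hcoord s i x *m A)) =
  expsum d (eigen_mass i x) 2 0.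
Proof.
rewrite !mul_spectral_mx dotmx_unitary//.
rewrite dotmx_sum raddf_sum; apply: eq_bigr => j _.
rewrite !mul_mx_diag !mxE mul0r expR0 mul1r /eigen_mass mxE.
set u := \sum_l _; case: u => a b; rewrite /sqnorm /=; ring.
Qed.

Lemma nrm2_moment0 i x : nrm2 (hcoord s i x) = expsum d (eigen_mass i x) 0 0.
Proof.
rewrite -sum_eigen_mass; apply: eq_bigr => j _.
by rewrite expr0 mul0r expR0 !mul1r.
Qed.

End bergman_geodesics.

(** * Integrals over X and differentiation under the integral sign *)

Section chart_integrals.
Context {R : realType} {n : nat} {X : complex_manifold R n}.
Context (P : subordinate_partition X).
Hypothesis cX : compact [set: X].
Implicit Types (f g : mindex X -> X -> R) (F G : X -> R).

(** The integrand is a family indexed by charts, since a volume density only exists chart by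
    chart. *)
Definition chart_integral f : R :=
  \sum_(p < psize P) \int[msp_measure (lebC R n)]_(q in piece_dom p)
    f (pchart p) (mparam (pchart p) (lebC_point q)).

(** Nothing is asked off the chart domain, where local functions carry junk values. *)
Definition chart_continuous f :=
  forall i x, mdom i x -> {for x, continuous (f i)}.

Lemma vol_integralE phi F : vol_integral P phi F =
  chart_integral (fun i x => 2 ^+ n * expR (- phi i x) * F x).
Proof. by []. Qed.

Lemma chart_param (p : 'I_(psize P)) (q : msp_type (lebC R n)) : piece_dom p q ->
  mdom (pchart p) (mparam (pchart p) (lebC_point q) : X).
Proof.
move=> [x px <-]; have ix := piece_mdom px.
by rewrite mchartK.
Qed.

Lemma eq_chart_integral f g : (forall i x, mdom i x -> f i x = g i x) ->
  chart_integral f = chart_integral g.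
Proof.
move=> fg; apply: eq_bigr => p _; apply: eq_Rintegral => q; rewrite inE => pq.
by apply: fg; exact: chart_param.
Qed.

Lemma chart_integralD f g : chart_continuous f -> chart_continuous g ->
  chart_integral (fun i x => f i x + g i x) = chart_integral f + chart_integral g.
Proof.
move=> cf cg; rewrite /chart_integral -big_split; apply: eq_bigr => p _.
rewrite RintegralD//; [exact: measurable_piece_dom|..].
  by apply: (integrable_piece cX) => x ix; exact: cf.
by apply: (integrable_piece cX) => x ix; exact: cg.
Qed.

Lemma chart_integralZ a f : chart_continuous f ->
  chart_integral (fun i x => a * f i x) = a * chart_integral f.
Proof.
move=> cf; rewrite /chart_integral mulr_sumr; apply: eq_bigr => p _.
rewrite RintegralZl//; first exact: measurable_piece_dom.
by apply: (integrable_piece cX) => x ix; exact: cf.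
Qed.

Lemma chart_integral_ge0 f : (forall i x, mdom i x -> 0 <= f i x) ->
  0 <= chart_integral f.
Proof.
move=> f0; apply: sumr_ge0 => p _; apply: Rintegral_ge0 => q pq.
by apply: f0; exact: chart_param.
Qed.

Lemma le_chart_integral f g : chart_continuous f -> chart_continuous g ->
  (forall i x, mdom i x -> f i x <= g i x) ->
  chart_integral f <= chart_integral g.
Proof.
move=> cf cg fg; apply: ler_sum => p _; apply: le_Rintegral.
- exact: measurable_piece_dom.
- by apply: (integrable_piece cX) => x ix; exact: cf.
- by apply: (integrable_piece cX) => x ix; exact: cg.
- by move=> q pq; apply: fg; exact: chart_param.
Qed.

Lemma is_derive_chart_integral (f0 f1 : R -> mindex X -> X -> R) g (r t : R) :
  `|t| < r -> chart_continuous g ->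
  (forall u, `|u| < r -> chart_continuous (f0 u)) ->
  (forall u i x, `|u| < r -> mdom i x ->
     is_derive u (1 : R) (fun v => f0 v i x) (f1 u i x)) ->
  (forall u i x, `|u| < r -> mdom i x -> `|f1 u i x| <= g i x) ->
  is_derive t (1 : R) (fun u => chart_integral (f0 u)) (chart_integral (f1 t)).
Proof.
move=> tr cg cf0 df0 f1g.
have -> : (fun u => chart_integral (f0 u)) = \sum_(p < psize P)
    (fun u => \int[msp_measure (lebC R n)]_(q in piece_dom p)
      f0 u (pchart p) (mparam (pchart p) (lebC_point q))).
  by apply/funext => u; rewrite fct_sumE.
apply: is_derive_sum => p; set i := pchart p.
pose h u (q : msp_type (lebC R n)) := f0 u i (mparam i (lebC_point q)).
have It (u : R) : `]- r, r[%classic u = (`|u| < r) :> Prop.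
  by rewrite /= in_itv /= ltr_norml.
have dh u q : piece_dom p q -> `|u| < r ->
    is_derive u (1 : R) (h ^~ q) (f1 u i (mparam i (lebC_point q))).
  by move=> pq ur; apply: df0 => //; exact: chart_param.
have d1 u q : piece_dom p q -> `|u| < r ->
    partial1of2 h u q = f1 u i (mparam i (lebC_point q)).
  move=> pq ur; rewrite partial1of2E.
  by have hd := dh _ _ pq ur; exact: derive_val.
have mp := @measurable_piece_dom _ _ _ P p.
have ih x : `]- r, r[%classic x ->
    (msp_measure (lebC R n)).-integrable (piece_dom p) (EFin \o h x).
  rewrite It => xr; apply: (integrable_piece cX) => y iy; exact: cf0.
have derh x q : `]- r, r[%classic x -> piece_dom p q -> derivable (h ^~ q) x 1.
  by rewrite It => xr pq; have [] := dh _ _ pq xr.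
(* The hypothesis on [g] speaks only of chart points, whereas a dominating function must be
   nonnegative everywhere; hence the absolute value. *)
have ig : (msp_measure (lebC R n)).-integrable (piece_dom p)
    (EFin \o (fun q => `|g i (mparam i (lebC_point q))|)).
  apply: (integrable_piece cX (F := fun x => `|g i x|)) => x ix.
  by apply: cvg_norm; exact: cg.
have ub x q : `]- r, r[%classic x -> piece_dom p q ->
    `|partial1of2 h x q| <= `|g i (mparam i (lebC_point q))|.
  rewrite It => xr pq; rewrite d1//.
  by apply: le_trans (ler_norm _); apply: f1g => //; exact: chart_param.
have rt : `]- r, r[%classic t by rewrite It.
apply: DeriveDef.
  exact: (derivable_under_integral mp rt ih derh (fun=> normr_ge0 _) ig ub).
rewrite -derive1E.
rewrite (differentiation_under_integral mp rt ih derh (fun=> normr_ge0 _) ig ub).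
by apply: eq_Rintegral => q; rewrite inE => pq; exact: d1.
Qed.

End chart_integrals.

(** * Second derivative of the logarithm of an integral *)

Section log_integral.
Context {R : realType}.

(** [I] is known to be positive only near 0, by continuity. The formula for [derive1 f] thus holds
    near 0, which suffices for its derivative at 0. *)
Lemma derive2_linear_subr_ln (c : R) (I I1 : R -> R) (I2 r : R) : 0 < r ->
  (forall t, `|t| < r -> is_derive t (1 : R) I (I1 t)) ->
  is_derive (0 : R) (1 : R) I1 I2 -> 0 < I 0 ->
  let f t := c * t - ln (I t) in
  (\forall t \near (0 : R), derivable f t (1 : R)) /\
  is_derive (0 : R) (1 : R) (derive1 f) (- (I2 / I 0 - (I1 0 / I 0) ^+ 2)).
Proof.
move=> r0 dI dI1 I0 f.
have d0 : is_derive (0 : R) (1 : R) I (I1 0) by apply: dI; rewrite normr0.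
have I_gt0 : \forall t \near (0 : R), 0 < I t.
  have cI : {for (0 : R), continuous I}.
    by apply/differentiable_continuous/derivable1_diffP; case: d0.
  exact: (cvgr_gt _ cI).
have tr : \forall t \near (0 : R), `|t| < r.
  have /= := @nbhsx_ballx R R 0 r r0.
  by apply: filterS => t; rewrite /ball /= sub0r normrN.
have df t : 0 < I t -> `|t| < r -> is_derive t (1 : R) f (c - I1 t / I t).
  move=> It tr'; have hI := dI _ tr'.
  have hl : is_derive t (1 : R) (fun u => ln (I u)) ((I t)^-1 * I1 t).
    by apply: is_derive1_comp; exact: is_derive1_ln.
  rewrite /f; apply: is_derive_eq; rewrite /GRing.scale /=; ring.
split.
  by near=> t; have [] : is_derive t (1 : R) f (c - I1 t / I t); first by
    apply: df; near: t.
have h : is_derive (0 : R) (1 : R) (fun t => c - I1 t / I t)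
    (- (I2 / I 0 - (I1 0 / I 0) ^+ 2)).
  have hV := is_deriveV (lt0r_neq0 I0) d0.
  apply: is_derive_eq; rewrite /GRing.scale /=; field.
  by rewrite gt_eqF.
apply: near_eq_is_derive h.
near=> t; rewrite derive1E; apply/esym.
by have hd : is_derive t (1 : R) f (c - I1 t / I t);
  [apply: df; near: t|exact: derive_val].
Unshelve. all: by end_near. Qed.

(** Serves the degenerate case of zero total volume. Differentiating twice needs the equality near
    every point close to 0, whence [near_join]. *)
Lemma derive2_linear (c : R) (f : R -> R) : (\forall t \near (0 : R), f t = c * t) ->
  (\forall t \near (0 : R), derivable f t (1 : R)) /\
  is_derive (0 : R) (1 : R) (derive1 f) 0.
Proof.
move=> fE; have fE2 := near_join fE.
have df t : (\forall u \near t, f u = c * u) -> is_derive t (1 : R) f c.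
  move=> ft; have h : is_derive t (1 : R) (fun u => c * u) c.
    by apply: is_derive_eq; rewrite /GRing.scale /=; ring.
  by apply: near_eq_is_derive h; apply: filterS ft => u ->.
split; first by apply: filterS fE2 => t /df [].
have h : is_derive (0 : R) (1 : R) (fun=> c) 0 by exact: is_derive_cst.
apply: near_eq_is_derive h; apply: filterS fE2 => t /df hd.
by rewrite derive1E; exact/esym/derive_val.
Qed.

End log_integral.

(** * Continuity of the weights in the point of X *)

Section weight_continuity.
Context {R : realType} {n : nat} {X : complex_manifold R n} {k N : nat}.
Context (s : 'I_N -> antican_section X k).
Hypotheses (bs : is_basis s) (va : very_ample X k).
Local Notation C := R[i].
Variables (P : 'M[C]_N) (d : 'I_N -> R) (q c : R).
Hypotheses (uP : P \is unitarymx) (c_gt0 : 0 < c).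
Local Notation mass := (eigen_mass s P).

Lemma continuous_eigen_mass i x j : mdom i x ->
  {for x, continuous (fun y => mass i y j : R)}.
Proof.
move=> ix; have h := @continuous_hcoord_mul _ _ _ _ _ s (P^t*) i x j ix.
have hR : {for x, continuous (fun y => complex.Re ((hcoord s i y *m P^t*) 0 j) : R)}.
  exact: (continuous_comp h (@continuous_Re R _)).
have hI : {for x, continuous (fun y => complex.Im ((hcoord s i y *m P^t*) 0 j) : R)}.
  exact: (continuous_comp h (@continuous_Im R _)).
by apply: (@cvgD R R^o); apply: (@cvgM R).
Qed.

Lemma continuous_expsum a t i x : mdom i x ->
  {for x, continuous (fun y => expsum d (mass i y) a t : R)}.
Proof.
move=> ix; apply: (@cvg_big R^o _ +%R); first exact: (@add_continuous R^o).
move=> j _; apply: (@cvgM R); first exact: cvg_cst.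
apply: (@cvgM R); first exact: cvg_cst.
exact: continuous_eigen_mass.
Qed.

Lemma mass_expsum_gt0 t i x : mdom i x -> 0 < expsum d (mass i x) 0 t.
Proof.
move=> ix; apply: expsum_gt0; first exact: eigen_mass_ge0.
exact: sum_eigen_mass_gt0.
Qed.

Lemma continuous_weight t i x : mdom i x ->
  {for x, continuous (fun y => weight d (mass i y) q c t : R)}.
Proof.
move=> ix; have e0 := mass_expsum_gt0 t ix.
have hc : {for x, continuous (fun y => c * expsum d (mass i y) 0 t : R)}.
  by apply: (@cvgM R); [exact: cvg_cst|exact: continuous_expsum].
have hl : {for x, continuous (fun y => ln (c * expsum d (mass i y) 0 t) : R)}.
  by apply: (continuous_comp hc); apply: continuous_ln; rewrite mulr_gt0.
have hq : {for x, continuous (fun y => - (q * ln (c * expsum d (mass i y) 0 t)) : R)}.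
  by apply: cvgN; apply: (@cvgM R); [exact: cvg_cst|].
by apply: (continuous_comp hq); exact: continuous_expR.
Qed.

Lemma continuous_moment a t i x : mdom i x ->
  {for x, continuous (fun y =>
    expsum d (mass i y) a t / expsum d (mass i y) 0 t : R)}.
Proof.
move=> ix; apply: (@cvgM R); first exact: continuous_expsum.
by apply: cvgV; [rewrite gt_eqF ?mass_expsum_gt0|exact: continuous_expsum].
Qed.

Lemma continuous_weight1 t i x : mdom i x ->
  {for x, continuous (fun y => weight1 d (mass i y) q c t : R)}.
Proof.
move=> ix; apply: (@cvgM R); last exact: continuous_weight.
apply: cvgN; apply: (@cvgM R); first exact: cvg_cst.
exact: continuous_moment.
Qed.

End weight_continuity.

Lemma unitarymx1 {F : numClosedFieldType} N : (1%:M : 'M[F]_N) \is unitarymx.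
Proof. by apply/unitarymxP; rewrite trmx1 map_mx1 mulmx1. Qed.

(** * Algebra of the velocity form and the hamiltonian *)

Section pointwise_forms.
Context {R : realType} {N : nat}.
Local Notation C := R[i].
Implicit Types (A B D : 'M[C]_N) (Z : 'rV[C]_N) (r : R).

Lemma hermsymmxZD A B r : A \is hermsymmx -> B \is hermsymmx ->
  r%:C *: A + B \is hermsymmx.
Proof.
move=> hA hB; apply/is_hermitianmxP; rewrite expr0 scale1r.
have hE (D : 'M[C]_N) i j : D \is hermsymmx -> Num.conj (D j i) = D i j.
  by move=> /hermsymmx_tr {2}->; rewrite !mxE.
apply/matrixP => i j; rewrite !mxE rmorphD rmorphM /= !hE//.
by rewrite conj_real_complex.
Qed.

Lemma velocity_formC A B Z : velocity_form A B Z = velocity_form B A Z.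
Proof. by rewrite /velocity_form dotmxC; case: (dotmx _ _). Qed.

Lemma Re_realM r (z : C) : complex.Re (r%:C * z) = r * complex.Re z.
Proof. by case: z => a b; rewrite /= mul0r subr0. Qed.

Lemma velocity_formZD A B D Z r :
  velocity_form (r%:C *: A + B) D Z = r * velocity_form A D Z + velocity_form B D Z.
Proof.
rewrite /velocity_form mulmxDr -scalemxAr linearDl linearZl_LR raddfD /=.
by rewrite Re_realM mulrDl mulrA.
Qed.

Lemma hamiltonianZD A B Z r :
  hamiltonian (r%:C *: A + B) Z = r * hamiltonian A Z + hamiltonian B Z.
Proof.
rewrite !hamiltonianE mulmxDr -scalemxAr linearDl linearZl_LR raddfD /=.
by rewrite Re_realM mulrDl mulrA.
Qed.

Lemma velocity_form_scale A B Z (a : C) : a != 0 ->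
  velocity_form A B (a *: Z) = velocity_form A B Z.
Proof.
move=> a0; rewrite /velocity_form nrm2Z -!scalemxAl linearZl_LR linearZr_LR /=.
rewrite mulrA mulCconj Re_realM; have [->|n0] := eqVneq (nrm2 Z) 0.
  by rewrite mulr0 invr0 !mulr0.
by field; rewrite n0 sqnorm_eq0.
Qed.

(** Lets the hamiltonian inherit frame independence and continuity from the velocity form. *)
Lemma velocity_form_hamiltonian A Z :
  hamiltonian A Z = velocity_form A 1%:M Z.
Proof. by rewrite hamiltonianE /velocity_form mulmx1. Qed.

End pointwise_forms.

(** * The candidate Hessian: symmetry and bilinearity *)

Section hessian.
Context {R : realType} {n : nat} {X : complex_manifold R n}.
Context (P : subordinate_partition X) {k N : nat} (H0 : 'B(X, k)).
Context (s : 'I_N -> antican_section X k).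
Local Notation C := R[i].
Hypotheses (cX : compact [set: X]) (k_gt0 : (0 < k)%N) (va : very_ample X k).
Hypotheses (bs : is_basis s) (os : is_orthonormal H0 s).
Implicit Types (A B D : 'M[C]_N) (F G : X -> R).

Let q : R := k%:R^-1.
Let c : R := k%:R ^- n.

Let q_ge0 : 0 <= q. Proof. by rewrite invr_ge0. Qed.
Let c_gt0 : 0 < c. Proof. by rewrite invr_gt0 exprn_gt0// ltr0n. Qed.

(** Changing frame multiplies the homogeneous coordinates by a nonzero scalar. The chart
    [chart_at x], which jumps with [x], may thus be replaced by a fixed one. *)
Lemma velocity_form_chart A B i x : mdom i x ->
  velocity_form A B (proj_coord s x) = velocity_form A B (hcoord s i x).
Proof.
move=> ix; rewrite (hcoord_chart s ix) velocity_form_scale//.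
have := hcoord_neq0 bs va (mdom_chart_at x).
rewrite -[hcoord _ _ _]/(proj_coord s x) (hcoord_chart s ix).
by apply: contraNneq => ->; rewrite scale0r.
Qed.

Lemma continuous_velocity_form A B :
  continuous (fun x => velocity_form A B (proj_coord s x)).
Proof.
move=> x; have ix := mdom_chart_at x.
apply: (@continuous_mdom_eq _ _ _ _ (chart_at x) x _
  (fun y => velocity_form A B (hcoord s (chart_at x) y))) => //.
  by move=> y iy; exact: velocity_form_chart.
apply: (@cvgM R); first exact: continuous_dotmx.
apply: cvgV; first by rewrite nrm2_eq0; exact: hcoord_neq0.
have := @continuous_dotmx _ _ _ _ _ s 1%:M 1%:M _ _ ix.
rewrite (_ : (fun y => _) = (fun y => nrm2 (hcoord s (chart_at x) y)))//.
by apply/funext => y; rewrite !mulmx1 dotmx_nrm2.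
Qed.

Lemma continuous_hamiltonian A :
  continuous (fun x => hamiltonian A (proj_coord s x)).
Proof.
under eq_fun do rewrite velocity_form_hamiltonian.
exact: continuous_velocity_form.
Qed.

Lemma continuous_density F : continuous F ->
  chart_continuous (fun i x => 2 ^+ n * expR (- FS H0 i x) * F x).
Proof.
move=> cF i x ix; apply: (@cvgM R); last exact: cF.
apply: (@cvgM R); first exact: cvg_cst.
(* The density of [H0] is a weight for the trivial data P = Id and d = 0. *)
apply: (@continuous_mdom_eq _ _ _ _ i x _
  (fun y => weight (fun=> 0) (eigen_mass s 1%:M i y) q c 0)) => //.
  move=> y iy; rewrite (FS_basepoint bs os va iy) /weight.
  by rewrite (@nrm2_moment0 _ _ _ _ _ s 1%:M (fun=> 0))// unitarymx1.
apply: continuous_weight => //; exact: unitarymx1.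
Qed.

Lemma vol_integralZ F (a : R) : continuous F ->
  vol_integral P (FS H0) (fun x => a * F x) = a * vol_integral P (FS H0) F.
Proof.
move=> cF; rewrite !vol_integralE -chart_integralZ//; last exact: continuous_density.
by apply: eq_chart_integral => i x ix; ring.
Qed.

Lemma vol_integralZD F G (a : R) : continuous F -> continuous G ->
  vol_integral P (FS H0) (fun x => a * F x + G x) =
  a * vol_integral P (FS H0) F + vol_integral P (FS H0) G.
Proof.
move=> cF cG; rewrite !vol_integralE -chart_integralZ//; last exact: continuous_density.
rewrite -chart_integralD//; last exact: continuous_density.
  by apply: eq_chart_integral => i x ix; ring.
move=> i x ix; apply: (@cvgM R); first exact: cvg_cst.
exact: continuous_density.
Qed.

Lemma mu_integralZD F G (a : R) : continuous F -> continuous G ->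
  mu_integral P (FS H0) (fun x => a * F x + G x) =
  a * mu_integral P (FS H0) F + mu_integral P (FS H0) G.
Proof.
by move=> cF cG; rewrite /mu_integral vol_integralZD// mulrDl mulrA.
Qed.

(** The integrals are abstracted as real numbers, so that symmetry and linearity of the formula
    become ring identities. *)
Definition hessian_value (i hh ha hb : R) : R :=
  q * i - k%:R ^- 2 * hh + k%:R ^- 2 * (ha * hb).

Lemma bilinear_sub_prod (r a b h1 h2 h : R) :
  r * a + b - (r * h1 + h2) * h = r * (a - h1 * h) + (b - h2 * h).
Proof. by ring. Qed.

Lemma hessian_valueC i hh ha hb i' hh' : i = i' -> hh = hh' ->
  hessian_value i hh ha hb = hessian_value i' hh' hb ha.
Proof. by move=> -> ->; rewrite /hessian_value [ha * _]mulrC. Qed.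

Lemma hessian_valueZD (r i1 i2 i hh1 hh2 hh ha1 ha2 ha hb : R) :
  i = r * i1 + i2 -> hh = r * hh1 + hh2 -> ha = r * ha1 + ha2 ->
  hessian_value i hh ha hb =
    r * hessian_value i1 hh1 ha1 hb + hessian_value i2 hh2 ha2 hb.
Proof. by move=> -> -> ->; rewrite /hessian_value; ring. Qed.

Local Notation ham A := (fun x => hamiltonian A (proj_coord s x)).
Local Notation inner A B :=
  (fun x => complex.Re (fs_inner A B (proj_coord s x))).
Local Notation mean := (mu_integral P (FS H0)).

Definition hessian A B : R := hessian_value (mean (inner A B))
  (mean (fun x => hamiltonian A (proj_coord s x) * hamiltonian B (proj_coord s x)))
  (mean (ham A)) (mean (ham B)).

Lemma proj_coord_neq0 x : proj_coord s x != 0.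
Proof. exact: hcoord_neq0 (mdom_chart_at x). Qed.

Lemma Re_fs_inner_proj A B : A \is hermsymmx -> B \is hermsymmx -> forall x,
  complex.Re (fs_inner A B (proj_coord s x)) = velocity_form A B (proj_coord s x)
    - hamiltonian A (proj_coord s x) * hamiltonian B (proj_coord s x).
Proof. by move=> hA hB x; apply: Re_fs_inner => //; exact: proj_coord_neq0. Qed.

Lemma hessianC : {in hermsymmx &, forall A B, hessian A B = hessian B A}.
Proof.
move=> A B hA hB; apply: hessian_valueC; apply: congr1; apply/funext => x.
  apply: (etrans (Re_fs_inner_proj hA hB x)).
  apply: (etrans _ (esym (Re_fs_inner_proj hB hA x))).
  exact: (congr2 (fun u v => u - v) (velocity_formC _ _ _) (mulrC _ _)).
exact: mulrC.
Qed.

Lemma continuous_hamiltonianM A B : continuous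
  (fun x => hamiltonian A (proj_coord s x) * hamiltonian B (proj_coord s x)).
Proof. by move=> x; apply: (@cvgM R); exact: continuous_hamiltonian. Qed.

Lemma continuous_inner A B : A \is hermsymmx -> B \is hermsymmx ->
  continuous (inner A B).
Proof.
move=> hA hB; have -> := funext (Re_fs_inner_proj hA hB).
move=> x; apply: (@cvgB R R^o); first exact: continuous_velocity_form.
exact: continuous_hamiltonianM.
Qed.

Lemma hessianZD : {in hermsymmx & &, forall A B D, forall r : R,
  hessian (r%:C *: A + B) D = r * hessian A D + hessian B D}.
Proof.
move=> A B D hA hB hD r; apply: hessian_valueZD.
- apply: etrans _ (mu_integralZD r (continuous_inner hA hD) (continuous_inner hB hD)).
  apply: congr1; apply/funext => x.
  apply: (etrans (Re_fs_inner_proj (hermsymmxZD r hA hB) hD x)).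
  apply: (etrans _ (esym (congr2 (fun u v => r * u + v)
    (Re_fs_inner_proj hA hD x) (Re_fs_inner_proj hB hD x)))).
  apply: (etrans (congr2 (fun u v => u - v * hamiltonian D (proj_coord s x))
    (velocity_formZD A B D (proj_coord s x) r)
    (hamiltonianZD A B (proj_coord s x) r))).
  exact: bilinear_sub_prod.
- rewrite -mu_integralZD; [|exact: continuous_hamiltonianM..].
  apply: congr1; apply/funext => x.
  apply: (etrans (congr1 (fun v => v * hamiltonian D (proj_coord s x))
    (hamiltonianZD A B (proj_coord s x) r))).
  by rewrite mulrDl mulrA.
- rewrite -mu_integralZD; [|exact: continuous_hamiltonian..].
  by apply: congr1; apply/funext => x; exact: hamiltonianZD.
Qed.

(** * Second derivative of the Ding functional along a geodesic *)

Section geodesic.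
Variables (U : 'M[C]_N) (d : 'I_N -> R).
Hypothesis uU : U \is unitarymx.
Let A : 'M[C]_N := spectral_mx U (\row_j (d j)%:C).
Local Notation mass := (eigen_mass s U).
Let D := \sum_j `|d j|.

Lemma vol_integral_geodesic t :
  vol_integral P (FS (bergman_geodesic H0 s A t)) (fun=> 1) =
  chart_integral P (fun i x => 2 ^+ n * weight d (mass i x) q c t).
Proof.
rewrite vol_integralE; apply: eq_chart_integral => i x ix.
by rewrite FS_geodesic// mulr1.
Qed.

Lemma FS_weight0 i x : mdom i x -> expR (- FS H0 i x) = weight d (mass i x) q c 0.
Proof.
by move=> ix; rewrite (FS_basepoint bs os va ix) /weight -(nrm2_moment0 s d uU).
Qed.

Lemma moment1_hamiltonian i x : mdom i x ->
  expsum d (mass i x) 1 0 / expsum d (mass i x) 0 0 = hamiltonian A (proj_coord s x).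
Proof.
move=> ix; rewrite velocity_form_hamiltonian (velocity_form_chart _ _ ix).
by rewrite -velocity_form_hamiltonian hamiltonianE nrm2_moment1// (nrm2_moment0 s d uU).
Qed.

Lemma moment2_velocity_form i x : mdom i x ->
  expsum d (mass i x) 2 0 / expsum d (mass i x) 0 0 =
  velocity_form A A (proj_coord s x).
Proof.
move=> ix; rewrite (velocity_form_chart _ _ ix).
by rewrite /velocity_form nrm2_moment2// (nrm2_moment0 s d uU).
Qed.

(** The weight is a parameter: [weight] gives the volume along the geodesic, [weight1] and [weight2]
    its first two derivatives. *)
Definition vol_moment (w : (('I_N -> R) -> ('I_N -> R) -> R -> R -> R -> R)) t : R :=
  chart_integral P (fun i x => 2 ^+ n * w d (mass i x) q c t).

Lemma continuous_scaled_weight t (a : R) :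
  chart_continuous (fun i x => a * weight d (mass i x) q c t).
Proof.
by move=> i x ix; apply: (@cvgM R); [exact: cvg_cst|exact: continuous_weight].
Qed.

Lemma is_derive_vol_weight t : `|t| < 1 ->
  is_derive t (1 : R) (vol_moment (@weight R N)) (vol_moment (@weight1 R N) t).
Proof.
move=> t1; rewrite /vol_moment.
(* The dominating function combines [weight1_bound] with [weight_le]: a constant multiple of the
   density at t = 0. *)
apply: (@is_derive_chart_integral _ _ _ P cX
  (fun u i x => 2 ^+ n * weight d (mass i x) q c u)
  (fun u i x => 2 ^+ n * weight1 d (mass i x) q c u) (fun i x =>
  2 ^+ n * (q * D * expR (q * D)) * weight d (mass i x) q c 0) 1).
- exact: t1.
- exact: continuous_scaled_weight.
- by move=> u u1; exact: continuous_scaled_weight.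
- move=> u i x u1 ix.
  have h := @is_derive_weight _ _ d _ (@eigen_mass_ge0 _ _ _ _ _ s U i x)
    (sum_eigen_mass_gt0 bs va uU ix) q c c_gt0 u.
  by apply: is_derive_eq.
- move=> u i x u1 ix; rewrite normrM ger0_norm ?exprn_ge0//.
  rewrite -(mulrA (2 ^+ n)) ler_wpM2l ?exprn_ge0//.
  have m0 := @eigen_mass_ge0 _ _ _ _ _ s U i x.
  have mp := sum_eigen_mass_gt0 bs va uU ix.
  apply: le_trans (weight1_bound d m0 mp c q_ge0 u) _.
  rewrite -[X in _ <= X]mulrA ler_wpM2l//; last exact: weight_le (ltW u1).
  by rewrite mulr_ge0// sumr_ge0.
Qed.

Lemma is_derive_vol_weight1 t : `|t| < 1 ->
  is_derive t (1 : R) (vol_moment (@weight1 R N)) (vol_moment (@weight2 R N) t).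
Proof.
move=> t1; rewrite /vol_moment.
(* Same domination, with the constant of [weight2_bound]. *)
apply: (@is_derive_chart_integral _ _ _ P cX
  (fun u i x => 2 ^+ n * weight1 d (mass i x) q c u)
  (fun u i x => 2 ^+ n * weight2 d (mass i x) q c u) (fun i x =>
  2 ^+ n * ((q ^+ 2 * D ^+ 2 + q * (D ^+ 2 + D ^+ 2)) * expR (q * D))
  * weight d (mass i x) q c 0) 1).
- exact: t1.
- exact: continuous_scaled_weight.
- move=> u u1 i x ix; apply: (@cvgM R); first exact: cvg_cst.
  exact: continuous_weight1.
- move=> u i x u1 ix.
  have h := @is_derive_weight1 _ _ d _ (@eigen_mass_ge0 _ _ _ _ _ s U i x)
    (sum_eigen_mass_gt0 bs va uU ix) q c c_gt0 u.
  by apply: is_derive_eq.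
- move=> u i x u1 ix; rewrite normrM ger0_norm ?exprn_ge0//.
  rewrite -(mulrA (2 ^+ n)) ler_wpM2l ?exprn_ge0//.
  have m0 := @eigen_mass_ge0 _ _ _ _ _ s U i x.
  have mp := sum_eigen_mass_gt0 bs va uU ix.
  apply: le_trans (weight2_bound d m0 mp c q_ge0 u) _.
  rewrite -[X in _ <= X]mulrA ler_wpM2l//; last exact: weight_le (ltW u1).
  by rewrite addr_ge0// mulr_ge0// ?sqr_ge0// addr_ge0// sqr_ge0.
Qed.

Lemma vol_weight0 : vol_moment (@weight R N) 0 = vol_integral P (FS H0) (fun=> 1).
Proof.
rewrite vol_integralE; apply: eq_chart_integral => i x ix.
by rewrite FS_weight0// mulr1.
Qed.

Let h x := hamiltonian A (proj_coord s x).

Lemma vol_weight1 : vol_moment (@weight1 R N) 0 = - q * vol_integral P (FS H0) h.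
Proof.
rewrite -(vol_integralZ _ (continuous_hamiltonian (A := A))) vol_integralE.
apply: eq_chart_integral => i x ix.
by rewrite FS_weight0// /weight1 moment1_hamiltonian// /h; ring.
Qed.

Lemma vol_weight2 : A \is hermsymmx -> vol_moment (@weight2 R N) 0 =
  q ^+ 2 * vol_integral P (FS H0) (fun x => h x * h x)
  - q * vol_integral P (FS H0) (fun x => complex.Re (fs_inner A A (proj_coord s x))).
Proof.
move=> hA.
have chh : continuous (fun x => h x * h x) by exact: continuous_hamiltonianM.
have cI := continuous_inner hA hA.
have cqI : continuous
    (fun x => - q * complex.Re (fs_inner A A (proj_coord s x))).
  by move=> x; apply: (@cvgM R); [exact: cvg_cst|exact: cI].
transitivity (vol_integral P (FS H0) (fun x => q ^+ 2 * (h x * h x)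
  - q * complex.Re (fs_inner A A (proj_coord s x)))); last first.
  transitivity (vol_integral P (FS H0) (fun x => q ^+ 2 * (h x * h x)
    + (- q * complex.Re (fs_inner A A (proj_coord s x))))).
    by apply: congr1; apply/funext => x; rewrite mulNr.
  by rewrite (vol_integralZD _ chh cqI) (vol_integralZ _ cI) mulNr.
rewrite vol_integralE; apply: eq_chart_integral => i x ix.
rewrite /weight2 (moment1_hamiltonian ix) (moment2_velocity_form ix).
rewrite (Re_fs_inner_proj hA hA x) (FS_weight0 ix).
rewrite /h; move: (velocity_form A A (proj_coord s x))
  (hamiltonian A (proj_coord s x)) (weight d (mass i x) q c 0) => v b w.
by ring.
Qed.

Lemma ding_geodesic t : ding P H0 s (bergman_geodesic H0 s A t) =
  - ((k * N)%:R^-1 * \sum_j d j) * t - ln (vol_moment (@weight R N) t).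
Proof.
rewrite /ding det_gram_geodesic// vol_integral_geodesic; congr (_ - _).
by ring.
Qed.

Lemma ding_second_derivative : A \is hermsymmx ->
  let f t := ding P H0 s (bergman_geodesic H0 s A t) in
  (\forall t \near (0 : R), derivable f t (1 : R)) /\
  is_derive (0 : R) (1 : R) (derive1 f) (hessian A A).
Proof.
move=> hA f; pose I := vol_moment (@weight R N).
pose c1 := - ((k * N)%:R^-1 * \sum_j d j).
have -> : f = (fun t => c1 * t - ln (I t)).
  by apply/funext => t; exact: ding_geodesic.
have r01 : `|0 : R| < 1 by rewrite normr0.
have I_ge0 t : 0 <= I t.
  apply: chart_integral_ge0 => i x _.
  by rewrite mulr_ge0 ?exprn_ge0// weight_ge0.
(* The logarithm is differentiable only at positive values, and so far [I 0] is only known to be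
   nonnegative. *)
have [I0|I0] := ltP 0 (I 0).
  have [df ddf] := derive2_linear_subr_ln c1 ltr01 is_derive_vol_weight
    (is_derive_vol_weight1 r01) I0.
  split => //; apply: is_derive_eq ddf _.
  move: I0; rewrite /I vol_weight1 (vol_weight2 hA) vol_weight0.
  rewrite /hessian /mu_integral /hessian_value -/q -exprVn -/q.
  move: (vol_integral P (FS H0) (fun=> 1)) => v v0.
  rewrite /h.
  move: (vol_integral _ _ _) (vol_integral _ _ _) (vol_integral _ _ _) => a b e.
  by field; rewrite gt_eqF.
(* If the volume vanishes at [t = 0] then it vanishes for all [|t| < 1] by
   [weight_le]; as [ln 0 = 0] and [x / 0 = 0], both sides are then 0. *)
have {}I0 : I 0 = 0 by apply/eqP; rewrite eq_le I0 I_ge0.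
have -> : hessian A A = 0.
  rewrite /hessian /mu_integral -vol_weight0 -/I I0 /hessian_value.
  by rewrite !invr0 !mulr0 subr0 addr0.
apply: (@derive2_linear _ c1).
have near1 : \forall t \near (0 : R), `|t| < 1.
  have /= := @nbhsx_ballx R R 0 1 ltr01.
  by apply: filterS => t; rewrite /ball /= sub0r normrN.
apply: filterS near1 => t t1.
have -> : I t = 0.
  apply/eqP; rewrite eq_le I_ge0 andbT -(mulr0 (expR (q * D))) -I0.
  rewrite /I /vol_moment -chart_integralZ//; last exact: continuous_scaled_weight.
  apply: le_chart_integral => //.
  - exact: continuous_scaled_weight.
  - move=> i x ix; apply: (@cvgM R); first exact: cvg_cst.
    exact: continuous_scaled_weight.
  - move=> i x ix; rewrite mulrCA ler_wpM2l ?exprn_ge0//.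
    apply: weight_le => //; [|exact: sum_eigen_mass_gt0|exact: ltW].
    exact: eigen_mass_ge0.
by rewrite ln0// subr0.
Qed.

End geodesic.

End hessian.

(** * Existence and uniqueness of the Hessian *)

Lemma ding_hessianP (R : realType) (n : nat) (X : complex_manifold R n)
    (P : subordinate_partition X) (k N : nat) (H0 : 'B(X, k))
    (s : 'I_N -> antican_section X k) :
  compact [set: X] -> (0 < k)%N -> very_ample X k ->
  is_basis s -> is_orthonormal H0 s -> is_ding_hessian P H0 s (hessian P H0 s).
Proof.
move=> cX k0 va bs os; split.
- by move=> A B hA hB; exact: hessianC.
- by move=> A B D hA hB hD r; exact: hessianZD.
(* [hessian] does not refer to a diagonalization, so each [A] may be treated in its own
   eigenbasis. *)
move=> A hA; have [U [e [uU eR AE]]] := hermsymmx_spectral hA.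
have eE : e = \row_j (complex.Re (e 0 j))%:C.
  by apply/rowP => j; rewrite mxE; exact/esym/RRe_real.
rewrite eE in AE; move: hA; rewrite AE => hA.
exact: ding_second_derivative.
Qed.

Lemma is_ding_hessian_unique (R : realType) (n : nat) (X : complex_manifold R n)
    (P : subordinate_partition X) (k N : nat) (H0 : 'B(X, k))
    (s : 'I_N -> antican_section X k) (Q Q' : 'M[R[i]]_N -> 'M[R[i]]_N -> R) :
  is_ding_hessian P H0 s Q -> is_ding_hessian P H0 s Q' ->
  {in hermsymmx &, forall A B, Q A B = Q' A B}.
Proof.
move=> [Qc Ql Qd] [Q'c Q'l Q'd] A B hA hB.
(* Both diagonal values are the derivative at 0 of one and the same function. *)
have QQ' D : D \is hermsymmx -> Q D D = Q' D D.
  move=> hD; have [_ h1] := Qd _ hD; have [_ h2] := Q'd _ hD.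
  by rewrite -(derive_val (is_derive := h1)) (derive_val (is_derive := h2)).
have hS := hermsymmxZD 1 hA hB.
(* A + B is written with the scalar 1 to match the shape of the linearity clause. *)
have polar (T : 'M[R[i]]_N -> 'M[R[i]]_N -> R) :
    {in hermsymmx &, forall A B, T A B = T B A} ->
    {in hermsymmx & &, forall A B C, forall r : R,
      T (r%:C *: A + B) C = r * T A C + T B C} ->
    2 * T A B = T (1%:C *: A + B) (1%:C *: A + B) - T A A - T B B.
  move=> Tc Tl; rewrite (Tl _ _ _ hA hB hS) (Tc _ _ hA hS) (Tc _ _ hB hS).
  rewrite (Tl _ _ _ hA hB hA) (Tl _ _ _ hA hB hB) (Tc _ _ hB hA).
  by ring.
have := polar _ Qc Ql; rewrite (QQ' _ hS) (QQ' _ hA) (QQ' _ hB).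
rewrite -(polar _ Q'c Q'l); exact: mulfI.
Qed.

Theorem theorem1p1 (R : realType) (n : nat) (X : complex_manifold R n)
    (P : subordinate_partition X) (k N : nat) (H0 : 'B(X, k))
    (s : 'I_N -> antican_section X k) :
  fano X -> (0 < k)%N -> very_ample X k ->
  is_basis s -> is_orthonormal H0 s ->
  (exists Q, is_ding_hessian P H0 s Q) /\
  (forall Q, is_ding_hessian P H0 s Q ->
   forall A B : 'M[R[i]]_N, A \is hermsymmx -> B \is hermsymmx ->
   Q A B =
     k%:R^-1 * mu_integral P (FS H0)
       (fun x => complex.Re (fs_inner A B (proj_coord s x)))
     - k%:R ^- 2 * mu_integral P (FS H0)
       (fun x => hamiltonian A (proj_coord s x) * hamiltonian B (proj_coord s x))
     + k%:R ^- 2 *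
       (mu_integral P (FS H0) (fun x => hamiltonian A (proj_coord s x)) *
        mu_integral P (FS H0) (fun x => hamiltonian B (proj_coord s x)))).
Proof.
move=> [_ cX _ _ _] k0 va bs os.
have hess := ding_hessianP P cX k0 va bs os.
split; first by exists (hessian P H0 s).
move=> Q hQ A B hA hB; exact: (is_ding_hessian_unique hQ hess hA hB).
Qed.
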